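(* The entropy-regularized MDP (ER-MDP) framework and the stochastic extreme-value MDP (EV-MDP) framework are equivalent, and each of them strictly subsumes the standard unconstrained MDP framework.
   Context: Setting. An MDP model is specified by a tuple $(\mathcal S,\mathcal A,q,\gamma)$ with $\mathcal S$ a finite set of states, $\mathcal A$ a finite set of actions, $q(s'|s,a)$ the transition probabilities, $\gamma\in[0,1)$ the discount factor, together with the extra data below; the reward function $r=(r(a|s))\in\mathbb R^{|\mathcal S|\times|\mathcal A|}$ is an input to the model. $\Delta^\pi$ is the set of policies $\pi$ with $\pi(a|s)\ge0$, $\sum_a\pi(a|s)=1$ for all $s$. Trajectories are $\tau=(s_0,a_0,s_1,a_1,\dots)$, and the value function at $s$ is the optimal value conditional on $s_0=s$. Standard MDP: $V(s)=\sup_{\pi^t\in\Delta^\pi,\,t\ge0}\mathbb E_{\tau}[\sum_{t\ge0}\gamma^t r(a_t|s_t)\mid s_0=s]$. ER-MDP (parameter $\eta\ge0$): $V(s)=\sup_{\pi^t\in\Delta^\pi,\,t\ge0}\mathbb E_{\tau}[\sum_{t\ge0}\gamma^t(r(a_t|s_t)+\phi_{s_t}(\pi^t_{s_t}))\mid s_0=s]$ with $\phi_s(\pi_s)=-\eta\sum_{a\in\mathcal A}\pi(a|s)\ln\pi(a|s)$ (convention $0\ln 0=0$). The ER-MDP framework is the set of all such models. EV-MDP (parameter $\eta\ge0$): the reward is $r(a|s)+\eta\,\epsilon(a|s)$, where at every time step the noises $\epsilon(a|s)$ are drawn i.i.d. over $(a,s)$ (and over time) from the Gumbel (Extreme Value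 Type I) distribution. At time $t$ and state $s$ the agent observes the noise vector $\epsilon_s=(\epsilon(a|s))_{a}$ and takes the action $\psi^t(s|\epsilon_s)\in\mathcal A$ given by a decision rule; $V(s)=\sup_{\psi^0,\psi^1,\dots}\mathbb E[\sum_{t\ge0}\gamma^t(r(a_t|s_t)+\eta\epsilon(a_t|s_t))\mid s_0=s]$. An optimal decision rule is $\psi(s|\epsilon_s)=\mathrm{argmax}_a\{r(a|s)+\eta\epsilon(a|s)+\gamma\sum_{s'}q(s'|s,a)V(s')\}$, and the associated policy is $\pi(a|s)=\mathbb P_\epsilon(\psi(s|\epsilon_s)=a)$. The EV-MDP framework is the set of all such models. Equivalence of models: two models $X,Y$ are equivalent, $X\equiv Y$, iff they have the same tuple $(\mathcal S,\mathcal A,q,\gamma)$ and there is a constant vector $\alpha\in\mathbb R^{|\mathcal S|\times|\mathcal A|}$ such that, for any reward functions $r^X,r^Y$ with $r^X-r^Y=\alpha$, model $X$ with rewards $r^X$ and model $Y$ with rewards $r^Y$ yield the same value function and a common stationary optimal policy $\{\pi^*(a|s)\}$. Equivalence of frameworks: frameworks (sets of models) $\mathcal X,\mathcal Y$ are equivalent iff for each $X\in\mathcal X$ there is $Y\in\mathcal Y$ with $X\equiv Y$, and vice versa. Strict subsumption: $\mathcal X$ strictly subsumes $\mathcal Y$ iff for each $Y\in\mathcal Y$ there is $X\in\mathcal X$ with $X\equiv Y$, but there is $X\in\mathcal X$ such that no $Y\in\mathcal Y$ satisfies $X\equiv Y$. *)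

(* Defs.v *)
From HB Require Import structures.
From mathcomp Require Export all_boot all_order all_algebra.
From mathcomp Require Export all_classical all_reals all_analysis.

Set Implicit Arguments.
Unset Strict Implicit.
Unset Printing Implicit Defensive.
Import Order.TTheory GRing.Theory Num.Theory.
Import numFieldNormedType.Exports.

Local Open Scope classical_set_scope.
Local Open Scope ring_scope.

(* The action set is nonempty: otherwise there are no policies at all. *)
Record mdp (R : realType) := Mdp {
  state : finType;
  action : finType;
  trans : state -> action -> state -> R;   (* [trans s a s'] is q(s'|s,a) *)
  discount : R;
  action_gt0 : (0 < #|action|)%N;
  trans_ge0 : forall s a s', 0 <= trans s a s';
  trans_sum1 : forall s a, \sum_(s' : state) trans s a s' = 1;
  discount_ge0 : 0 <= discount;
  discount_lt1 : discount < 1 }.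

Definition reward (R : realType) (M : mdp R) := state M -> action M -> R.

Definition is_policy (R : realType) (M : mdp R)
    (pi : state M -> action M -> R) : Prop :=
  (forall s a, 0 <= pi s a) /\ (forall s, \sum_(a : action M) pi s a = 1).

(* [ln 0 = 0] in the library, and anyway [0 * ln 0 = 0]. *)
Definition entropy_bonus (R : realType) (A : finType) (eta : R) (p : A -> R) : R :=
  - eta * \sum_(a : A) p a * ln (p a).

(* The infinite-horizon trajectory measure is not available as a library
   object; expectations are taken on an arbitrary probability space carrying a
   state-action process whose law is the prescribed one. The law, and therefore
   the expectation of the return, does not depend on that space. *)

Definition path_event (T : Type) (S A : Type) (s_ : nat -> T -> S)
    (a_ : nat -> T -> A) (t : nat) (x : nat -> S) (b : nat -> A) : set T :=
  [set w | s_ t w = x t /\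
           forall u, (u < t)%N -> s_ u w = x u /\ a_ u w = b u].

(* (s_0, a_0, s_1, a_1, ...) is started at [s0] and controlled by [pi]: given
   the past and s_t, a_t has law pi^t(.|s_t), and then s_{t+1} has law
   q(.|s_t,a_t). *)
Definition policy_process (R : realType) (M : mdp R)
    (pi : nat -> state M -> action M -> R) (s0 : state M)
    (d : measure_display) (T : measurableType d) (P : probability T R)
    (s_ : nat -> T -> state M) (a_ : nat -> T -> action M) : Prop :=
  [/\ (forall t x, measurable (s_ t @^-1` [set x])) /\
      (forall t b, measurable (a_ t @^-1` [set b])),
      P (s_ 0%N @^-1` [set s0]) = 1%E,
      forall t x b,
        P (path_event s_ a_ t x b `&` a_ t @^-1` [set b t]) =
        (P (path_event s_ a_ t x b) * (pi t (x t) (b t))%:E)%E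
    & forall t x b,
        P (path_event s_ a_ t.+1 x b) =
        (P (path_event s_ a_ t x b `&` a_ t @^-1` [set b t]) *
         (trans (x t) (b t) (x t.+1))%:E)%E].

(* The series converges for bounded [u], and almost surely for Gumbel noise; a
   divergent series gets a default value. *)
Definition discounted_sum (R : realType) (gamma : R) (u : nat -> R) : R :=
  limn (series (fun t => gamma ^+ t * u t)).

(* [v] is E_tau[sum_t gamma^t g_t(s_t, a_t) | s_0 = s] under [pi]. *)
Definition policy_return (R : realType) (M : mdp R)
    (g : nat -> state M -> action M -> R)
    (pi : nat -> state M -> action M -> R) (s : state M) (v : \bar R) : Prop :=
  exists (d : measure_display) (T : measurableType d) (P : probability T R)
         (s_ : nat -> T -> state M) (a_ : nat -> T -> action M),
    policy_process pi s P s_ a_ /\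
    v = ('E_P[fun w => discounted_sum (discount M)
                         (fun t => g t (s_ t w) (a_ t w))])%E.

Definition standard_return (R : realType) (M : mdp R) (r : reward M)
    (pi : nat -> state M -> action M -> R) (s : state M) (v : \bar R) : Prop :=
  policy_return (fun=> r) pi s v.

Definition ER_return (R : realType) (M : mdp R) (eta : R) (r : reward M)
    (pi : nat -> state M -> action M -> R) (s : state M) (v : \bar R) : Prop :=
  policy_return (fun t x a => r x a + entropy_bonus eta (pi t x)) pi s v.

Definition is_gumbel (R : realType) (d : measure_display)
    (T : measurableType d) (P : probability T R) (X : {RV P >-> R}) : Prop :=
  forall z : R, cdf X z = (expR (- expR (- z)))%:E.

Definition rect_event (T : Type) (R : realType) (I : finType)
    (e : I -> T -> R) (B : I -> set R) : set T :=
  [set w | forall i, B i (e i w)].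

(* Taking [B i = setT] off a subfamily gives the product rule for it. *)
Definition iid_gumbel (R : realType) (d : measure_display)
    (T : measurableType d) (P : probability T R) (I : finType)
    (e : I -> {RV P >-> R}) : Prop :=
  (forall i, is_gumbel (e i)) /\
  forall B : I -> set R, (forall i, measurable (B i)) ->
    P (rect_event (fun i => e i : T -> R) B) =
    (\prod_(i : I) fine (P (e i @^-1` B i)))%:E.

(* Decision rules are Borel in the noise vector: the sigma-algebra on
   [A -> R] is the one generated by the coordinates. *)
Definition is_decision_rule (R : realType) (M : mdp R)
    (psi : state M -> (action M -> R) -> action M) : Prop :=
  forall s a,
    <<s [set C : set (action M -> R) | exists (c : action M) (U : set R),
           measurable U /\ C = [set e | U (e c)]] >> [set e | psi s e = a].

Definition noisy_path_event (R : realType) (T : Type) (S A : finType)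
    (s_ : nat -> T -> S) (a_ : nat -> T -> A) (e_ : nat -> S * A -> T -> R)
    (t : nat) (x : nat -> S) (b : nat -> A) (B : nat -> S * A -> set R) : set T :=
  path_event s_ a_ t x b `&`
  [set w | forall u, (u < t)%N -> rect_event (e_ u) (B u) w].

(* Given the past (states, actions and noises) and s_t, the noises at time t
   are i.i.d. Gumbel over (s, a); a_t is dictated by the rule; and then s_{t+1}
   has law q(.|s_t,a_t). *)
Definition rule_process (R : realType) (M : mdp R)
    (psi : nat -> state M -> (action M -> R) -> action M) (s0 : state M)
    (d : measure_display) (T : measurableType d) (P : probability T R)
    (s_ : nat -> T -> state M) (a_ : nat -> T -> action M)
    (e_ : nat -> state M * action M -> {RV P >-> R}) : Prop :=
  let e' t i : T -> R := e_ t i in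
  [/\ (forall t x, measurable (s_ t @^-1` [set x])) /\
      (forall t b, measurable (a_ t @^-1` [set b])),
      P (s_ 0%N @^-1` [set s0]) = 1%E,
      (forall t, iid_gumbel (e_ t)) /\
      (forall t x b B, (forall u i, measurable (B u i)) ->
        P (noisy_path_event s_ a_ e' t x b B `&` rect_event (e' t) (B t)) =
        (P (noisy_path_event s_ a_ e' t x b B) *
         P (rect_event (e' t) (B t)))%E),
      forall t w, a_ t w = psi t (s_ t w) (fun a => e' t (s_ t w, a) w)
    & forall t x b B, (forall u i, measurable (B u i)) ->
        P (noisy_path_event s_ a_ e' t.+1 x b B) =
        (P (noisy_path_event s_ a_ e' t x b B `&` rect_event (e' t) (B t) `&`
            a_ t @^-1` [set b t]) *
         (trans (x t) (b t) (x t.+1))%:E)%E].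

Definition EV_return (R : realType) (M : mdp R) (eta : R) (r : reward M)
    (psi : nat -> state M -> (action M -> R) -> action M)
    (s : state M) (v : \bar R) : Prop :=
  exists (d : measure_display) (T : measurableType d) (P : probability T R)
         (s_ : nat -> T -> state M) (a_ : nat -> T -> action M)
         (e_ : nat -> state M * action M -> {RV P >-> R}),
    rule_process psi s s_ a_ e_ /\
    v = ('E_P[fun w => discounted_sum (discount M)
                         (fun t => r (s_ t w) (a_ t w) +
                                   eta * e_ t (s_ t w, a_ t w) w)%R])%E.

Inductive criterion (R : realType) :=
  | Standard
  | EntropyRegularized of R
  | ExtremeValue of R.
Arguments Standard {R}.

Record model (R : realType) := Model {
  model_mdp : mdp R;
  model_criterion : criterion R }.

Definition policy_seq_value (R : realType) (M : mdp R)
    (ret : (nat -> state M -> action M -> R) -> state M -> \bar R -> Prop)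
    (s : state M) : \bar R :=
  ereal_sup [set v | exists2 pi : nat -> state M -> action M -> R,
                       (forall t, is_policy (pi t)) & ret pi s v].

Definition value (R : realType) (M : mdp R) (k : criterion R) (r : reward M)
    (s : state M) : \bar R :=
  match k with
  | Standard => policy_seq_value (standard_return r) s
  | EntropyRegularized eta => policy_seq_value (ER_return eta r) s
  | ExtremeValue eta =>
      ereal_sup [set v |
        exists2 psi : nat -> state M -> (action M -> R) -> action M,
          (forall t, is_decision_rule (psi t)) & EV_return eta r psi s v]
  end.

Definition EV_objective (R : realType) (M : mdp R) (eta : R) (r : reward M)
    (s : state M) (e : action M -> R) (a : action M) : R :=
  r s a + eta * e a +
  discount M * \sum_(s' : state M)
                 trans s a s' * fine (value (ExtremeValue eta) r s').

(* The rule attains the value from every state, and picks a maximizer of the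
   Bellman objective (any one of them when there are ties). *)
Definition EV_optimal_rule (R : realType) (M : mdp R) (eta : R) (r : reward M)
    (psi : state M -> (action M -> R) -> action M) : Prop :=
  [/\ is_decision_rule psi,
      forall s, EV_return eta r (fun=> psi) s (value (ExtremeValue eta) r s)
    & forall s e a, EV_objective eta r s e a <= EV_objective eta r s e (psi s e)].

(* pi(a|s) = P_epsilon(psi(s|epsilon_s) = a) *)
Definition policy_of_rule (R : realType) (M : mdp R)
    (psi : state M -> (action M -> R) -> action M)
    (pi : state M -> action M -> R) : Prop :=
  exists (d : measure_display) (T : measurableType d) (P : probability T R)
         (e : state M * action M -> {RV P >-> R}),
    iid_gumbel e /\
    forall s a, (pi s a)%:E = P [set w | psi s (fun c => e (s, c) w) = a].

Definition optimal_policy (R : realType) (M : mdp R) (k : criterion R)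
    (r : reward M) (pi : state M -> action M -> R) : Prop :=
  is_policy pi /\
  match k with
  | Standard => forall s, standard_return r (fun=> pi) s (value Standard r s)
  | EntropyRegularized eta =>
      forall s, ER_return eta r (fun=> pi) s (value (EntropyRegularized eta) r s)
  | ExtremeValue eta =>
      exists2 psi, EV_optimal_rule eta r psi & policy_of_rule psi pi
  end.

Definition equiv_model (R : realType) (X Y : model R) : Prop :=
  exists (M : mdp R) (k l : criterion R),
    [/\ X = Model M k, Y = Model M l &
      exists alpha : state M -> action M -> R,
      forall rX rY : reward M,
        (forall s a, rX s a - rY s a = alpha s a) ->
        (forall s, value k rX s = value l rY s) /\
        exists pi, optimal_policy k rX pi /\ optimal_policy l rY pi].

(* Not [set (model R)]: [model R] lives in too large a universe for [set]. *)
Definition framework (R : realType) := model R -> Prop.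

Definition equiv_framework (R : realType) (F G : framework R) : Prop :=
  (forall X, F X -> exists2 Y, G Y & equiv_model X Y) /\
  (forall Y, G Y -> exists2 X, F X & equiv_model X Y).

Definition strictly_subsumes (R : realType) (F G : framework R) : Prop :=
  (forall Y, G Y -> exists2 X, F X & equiv_model X Y) /\
  (exists2 X, F X & ~ exists2 Y, G Y & equiv_model X Y).

Definition standard_framework (R : realType) : framework R :=
  fun X => model_criterion X = Standard.

Definition ER_framework (R : realType) : framework R :=
  fun X => exists2 eta : R, 0 <= eta &
                            model_criterion X = EntropyRegularized eta.

Definition EV_framework (R : realType) : framework R :=
  fun X => exists2 eta : R, 0 <= eta &
                            model_criterion X = ExtremeValue eta.

Arguments standard_framework : clear implicits.
Arguments ER_framework : clear implicits.
Arguments EV_framework : clear implicits.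

(* Main.v *)
From HB Require Import structures.
From mathcomp Require Import ring lra measurable_realfun.
Require Import Defs.

(** Fix an MDP, [eta >= 0] and rewards [r].  Write [Q V s a] for the one-step
    value [r s a + gamma * \sum_s' q(s'|s,a) V s'] and [smax] for the
    log-sum-exp at temperature [eta] (the maximum if [eta = 0]).

    Entropy-regularized side: by the Gibbs variational principle, the best
    one-step randomization of the values [Q V s a] with entropy bonus is worth
    [smax (Q V s)] and is attained by the softmax ([gibbs_inequality],
    [gibbs_equality]).  Noisy side: Gumbel variables are max-stable, so the mean
    of the maximum of [Q V s a + eta * e a] is [smax (Q V s) + eta * m], with [m]
    the Gumbel mean ([integral_gumbel_max]); the probability that [a] is chosen
    is the derivative of this quantity in the direction [a], hence the softmax
    again ([choice_probability]).  So the two Bellman equations differ by the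
    constant [eta * m], which a constant shift of the rewards absorbs: after
    it the models share the solution [V] and the softmax policy.

    What turns a solution [V] of a Bellman equation into the value is a
    verification argument: discounted one-step inequalities telescope
    ([verification_le]), the series and the mean being exchanged by dominated
    convergence, and on each event [s_ t = x] the one-step inequality is one of
    the two facts above ([regularized_return_le], [noisy_return_le]).  The
    solution itself exists by a Knaster-Tarski argument
    ([bellman_fixpoint_exists]).  That the bound is attained requires a process
    that realizes the optimal rule ([rule_process_exists]).  It is built on a
    sequence of fair coins, namely the binary digits of Lebesgue measure:
    splitting it into even and odd places yields independent copies of itself,
    from which uniform and Gumbel variables and transitions are drawn, and a
    path event becomes a rectangle in independent blocks.  Forgetting the noise
    of this process gives the process of the softmax policy.

    At [eta = 0] both frameworks reduce to the standard one, which is therefore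
    subsumed.  Subsumption is strict because, with discount 0 and two actions,
    the value at [eta = 1] is a log-sum-exp up to a constant, and this is not
    the maximum of two shifted rewards ([log_sum_exp_not_max]). *)

Set Implicit Arguments.
Unset Strict Implicit.
Unset Printing Implicit Defensive.
Import Order.TTheory GRing.Theory Num.Theory.
Import numFieldNormedType.Exports.

Local Open Scope classical_set_scope.
Local Open Scope ring_scope.

(** * Fair coin tosses from the binary digits of Lebesgue measure *)

(** Restricting each coordinate to an arbitrary set of outcomes, rather than
    to a single outcome, makes this family closed under intersection. *)
Definition cylinders : set (set (nat -> bool)) :=
  [set A | exists n (B : nat -> bool -> bool),
     A = [set w | forall k, (k < n)%N -> B k (w k)]].

Definition coins := g_sigma_algebraType cylinders.
HB.instance Definition _ := Measurable.on coins.

Lemma cylinders_setI : setI_closed cylinders.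
Proof.
move=> _ _ [n [B ->]] [m [C ->]]; exists (maxn n m).
exists (fun k b => ((k < n)%N ==> B k b) && ((k < m)%N ==> C k b)).
apply/seteqP; split=> w /=.
  by move=> [hB hC] k _; apply/andP; split; apply/implyP => ?; [exact: hB|exact: hC].
move=> h; split=> k km.
  by have := h k; rewrite leq_max km => /(_ isT) /andP[].
by have := h k; rewrite leq_max km orbT => /(_ isT) /andP[].
Qed.

Lemma measurable_into_coins d (T : measurableType d) (f : T -> coins) :
  (forall k b, measurable [set w | f w k = b]) -> measurable_fun setT f.
Proof.
move=> mf; apply: (@measurability _ _ T coins setT f cylinders) => //.
move=> _ [_ [n [B ->]] <-]; rewrite setTI.
have -> : f @^-1` [set w | forall k, (k < n)%N -> B k (w k)] =
    \bigcap_k (if (k < n)%N then [set w | B k (f w k)] else setT).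
  apply/seteqP; split=> w /= h k.
    by move=> _; case: ifPn => // kn; exact: h.
  by move=> kn; have := h k I; rewrite kn.
apply: bigcap_measurable => [|k _]; first by exists 0%N.
case: ifPn => // _.
have -> : [set w | B k (f w k)] =
  (if B k true then [set w | f w k = true] else set0) `|`
  (if B k false then [set w | f w k = false] else set0).
  apply/seteqP; split=> w /=.
    by case E : (f w k) => h; [left|right]; rewrite h.
  by case=> h; [have [e|e] := boolP (B k true)|have [e|e] := boolP (B k false)];
    move: h; rewrite ?e ?(negbTE e) // => ->.
by apply: measurableU; case: ifP.
Qed.

Lemma measurable_coin (k : nat) (b : bool) :
  measurable [set w : coins | w k = b].
Proof.
apply: sub_sigma_algebra; exists k.+1, (fun j c => (j == k) ==> (c == b)).
apply/seteqP; split=> w /=.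
  by move=> <- j _; apply/implyP => /eqP ->.
by move=> /(_ k (ltnSn k)); rewrite eqxx /= => /eqP.
Qed.

Lemma measurable_cyl (n : nat) (B : nat -> bool -> bool) :
  measurable ([set w | forall k, (k < n)%N -> B k (w k)] : set coins).
Proof. by apply: sub_sigma_algebra; exists n, B. Qed.

Section doubling.
Context {R : realType}.
Local Notation mu := (@lebesgue_measure R).

(** On [0, 1[ this is doubling modulo 1, which shifts binary expansions. *)
Definition doubling (x : R) : R := if x < 2^-1 then 2 * x else 2 * x - 1.

Definition binary_digits (x : R) : coins :=
  fun k => 2^-1 <= iter k doubling x.

Lemma measurable_doubling : measurable_fun setT doubling.
Proof.
apply: measurable_fun_ifT.
- by apply: measurable_fun_ltr.
- exact: measurable_funM.
- apply: measurable_funB => //; exact: measurable_funM.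
Qed.

Lemma measurable_iter_doubling k : measurable_fun setT (iter k doubling).
Proof.
elim: k => [|k IH] /=; first exact: measurable_id.
by apply: (measurableT_comp (f := doubling)) => //; exact: measurable_doubling.
Qed.

Lemma measurable_binary_digits : measurable_fun setT binary_digits.
Proof.
apply: measurable_into_coins => k b.
have m : measurable_fun setT (fun x : R => 2^-1 <= iter k doubling x).
  by apply: measurable_fun_ler => //; exact: measurable_iter_doubling.
have := m measurableT [set b]; rewrite setTI; exact.
Qed.

(** The probability that a fair coin falls in [B]. *)
Definition coin_weight (B : bool -> bool) : R := ((B true)%:R + (B false)%:R) / 2.

(** The first [j] doublings are affine on a dyadic interval of length [2^-j],
    so that digit [j] tells its two halves apart.  Each half is again dyadic,
    one level down, whence the induction on the number of remaining digits. *)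
Lemma dyadic_cylinder_measure n j (a : R) (B : nat -> bool -> bool) :
  (forall x, a <= x < a + 2^-1 ^+ j -> iter j doubling x = 2 ^+ j * (x - a)) ->
  mu (`[a, a + 2^-1 ^+ j[%classic `&`
       [set x | forall k, (k < n)%N -> B (j + k)%N (binary_digits x (j + k)%N)]) =
  (2^-1 ^+ j * \prod_(k < n) coin_weight (B (j + k)%N))%:E.
Proof.
elim: n j a => [|n IH] j a aff.
  rewrite big_ord0 mulr1.
  rewrite (_ : _ `&` _ = `[a, a + 2^-1 ^+ j[%classic); last first.
    by apply/seteqP; split=> x /= [].
  rewrite lebesgue_measure_itv /= lte_fin ltrDl exprn_gt0 // -EFinB.
  by congr EFin; lra.
have p_gt0 : 0 < 2^-1 ^+ j :> R by rewrite exprn_gt0.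
have pp : 2 ^+ j * 2^-1 ^+ j = 1 :> R by rewrite -exprMn mulfV ?expr1n.
have hS : 2^-1 ^+ j.+1 = 2^-1 ^+ j / 2 :> R by rewrite exprS mulrC.
(* For [c] the left end of either half, [E c] is that half with the later digits. *)
pose E (c : R) := `[c, c + 2^-1 ^+ j.+1[%classic `&`
       [set x | forall k, (k < n)%N -> B (j.+1 + k)%N (binary_digits x (j.+1 + k)%N)].
have mE c : measurable (E c).
  apply: measurableI => //.
  have := measurable_binary_digits measurableT
    (measurable_cyl (j.+1 + n) (fun k b => (j < k)%N ==> B k b)).
  rewrite setTI; congr measurable; apply/seteqP; split=> x /=.
    move=> h k kn; have := h (j.+1 + k)%N.
    by rewrite ltn_add2l kn => /(_ isT) /implyP; apply; rewrite addSn ltnS leq_addr.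
  move=> h k kn; apply/implyP => jk; rewrite -(subnKC jk); apply: h.
  by rewrite ltn_subLR.
have dl x : a <= x < a + 2^-1 ^+ j.+1 -> iter j doubling x = 2 ^+ j * (x - a).
  by rewrite hS => /andP[x1 x2]; apply: aff; rewrite x1 /=; lra.
have dr x : a + 2^-1 ^+ j.+1 <= x < a + 2^-1 ^+ j.+1 + 2^-1 ^+ j.+1 ->
    iter j doubling x = 2 ^+ j * (x - a).
  by rewrite hS => /andP[x1 x2]; apply: aff; apply/andP; split; lra.
have bl x : a <= x < a + 2^-1 ^+ j.+1 -> (2^-1 <= iter j doubling x) = false.
  move=> xa; rewrite dl //; apply/negbTE; rewrite -ltNge.
  have : 2 ^+ j * (x - a) < 2 ^+ j * 2^-1 ^+ j.+1.
    by rewrite ltr_pM2l ?exprn_gt0 //; case/andP: xa; lra.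
  by rewrite hS mulrA pp; lra.
have br x : a + 2^-1 ^+ j.+1 <= x < a + 2^-1 ^+ j.+1 + 2^-1 ^+ j.+1 ->
    (2^-1 <= iter j doubling x) = true.
  move=> xa; rewrite dr //.
  have : 2 ^+ j * 2^-1 ^+ j.+1 <= 2 ^+ j * (x - a).
    by rewrite ler_pM2l ?exprn_gt0 //; case/andP: xa; lra.
  by rewrite hS mulrA pp; lra.
have IHl : mu (E a) =
    (2^-1 ^+ j.+1 * \prod_(k < n) coin_weight (B (j.+1 + k)%N))%:E.
  apply: IH => x xa; rewrite iterS /doubling; have := bl _ xa.
  by rewrite leNgt => /negbFE ->; rewrite dl // exprS; ring.
have IHr : mu (E (a + 2^-1 ^+ j.+1)) =
    (2^-1 ^+ j.+1 * \prod_(k < n) coin_weight (B (j.+1 + k)%N))%:E.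
  apply: IH => x xa; rewrite iterS /doubling; have := br _ xa.
  rewrite leNgt => /negbTE ->; rewrite dr // !exprS.
  have := pp; set u := 2 ^+ j; set v := 2^-1 ^+ j => uv.
  rewrite (_ : 2 * u * (x - (a + 2^-1 * v)) = 2 * (u * (x - a)) - u * v); last by field.
  by rewrite uv.
have split_bit x : (forall k, (k < n.+1)%N -> B (j + k)%N (binary_digits x (j + k)%N)) <->
   B j (binary_digits x j) /\
   (forall k, (k < n)%N -> B (j.+1 + k)%N (binary_digits x (j.+1 + k)%N)).
  split=> [h|[h0 h] [|k] kn].
  - split; first by have := h 0%N isT; rewrite addn0.
    by move=> k kn; have := h k.+1 kn; rewrite addSnnS.
  - by rewrite addn0.
  - by rewrite -addSnnS; exact: h.
rewrite (_ : _ `&` _ = (if B j false then E a else set0) `|`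
   (if B j true then E (a + 2^-1 ^+ j.+1) else set0)); last first.
  apply/seteqP; split=> x /=.
    rewrite in_itv /= => -[xa /split_bit[b0 bs]].
    have [xl|xr] := ltP x (a + 2^-1 ^+ j.+1).
      left; have xal : a <= x < a + 2^-1 ^+ j.+1 by case/andP: xa => -> _.
      move: b0; rewrite /binary_digits bl // => ->.
      by split => //=; rewrite in_itv.
    right; have xar : a + 2^-1 ^+ j.+1 <= x < a + 2^-1 ^+ j.+1 + 2^-1 ^+ j.+1.
      by rewrite xr; case/andP: xa => _; move: hS; lra.
    move: b0; rewrite /binary_digits br // => ->.
    by split => //=; rewrite in_itv.
  case; case: ifP => //= Bj [] /=; rewrite in_itv /= => xa bs; split.
  - by rewrite in_itv /=; case/andP: xa; move: hS; lra.
  - by apply/split_bit; split => //; rewrite /binary_digits bl.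
  - by rewrite in_itv /=; case/andP: xa; move: hS; lra.
  - by apply/split_bit; split => //; rewrite /binary_digits br.
rewrite measureU; last 3 first.
- by case: (B j false) => //; exact: mE.
- by case: (B j true) => //; exact: mE.
- apply/seteqP; split=> x //= [].
  case: ifP => // _ [] /=; rewrite in_itv /= => /andP[_ xl] _.
  by case: ifP => // _ [] /=; rewrite in_itv /= => /andP[xr _]; move: xl; rewrite ltNge xr.
rewrite big_ord_recl addn0.
under [in RHS]eq_bigr do rewrite lift0 -addSnnS.
rewrite /coin_weight.
have [_|_] := boolP (B j false); have [_|_] := boolP (B j true);
  rewrite /= ?IHl ?IHr ?measure0 ?add0e ?adde0 -?EFinD.
- by congr EFin; rewrite hS; field.
- by congr EFin; rewrite hS; field.
- by congr EFin; rewrite hS; field.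
- by rewrite /= addr0 !mul0r mulr0.
Qed.

End doubling.

(** [pushforward] bundled with the measurability proof from which its measure
    structure is built. *)
Definition image_measure d d' (T1 : measurableType d) (T2 : measurableType d')
    (R : realFieldType) (m : {measure set T1 -> \bar R}) (f : T1 -> T2)
    (mf : measurable_fun setT f) : {measure set T2 -> \bar R}.
Proof. by refine (pushforward m f : {measure set T2 -> \bar R}). Defined.

Section coin_probability.
Context {R : realType}.
Local Notation mu := (@lebesgue_measure R).

Let measurable_unit_interval :
  measurable (`[0, 1[%classic : set (measurableTypeR R)).
Proof. exact: measurable_itv. Qed.

Definition unit_interval_prob : set (measurableTypeR R) -> \bar R :=
  mrestr mu measurable_unit_interval.

HB.instance Definition _ := Measure.on unit_interval_prob.

Lemma unit_interval_prob_setT : unit_interval_prob setT = 1%E.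
Proof.
by rewrite /unit_interval_prob /mrestr setTI lebesgue_measure_itv /= lte_fin ltr01 oppr0 adde0.
Qed.

HB.instance Definition _ := Measure_isProbability.Build _ _ _
  unit_interval_prob unit_interval_prob_setT.

(** Same function; its domain carries the sigma-algebra on which Lebesgue
    measure is defined. *)
Definition digits : measurableTypeR R -> coins := @binary_digits R.

HB.instance Definition _ := isMeasurableFun.Build _ _ _ _
  digits measurable_binary_digits.

Definition coin_prob : probability coins R :=
  distribution unit_interval_prob digits.

Lemma coin_prob_cylinder n (B : nat -> bool -> bool) :
  coin_prob [set w | forall k, (k < n)%N -> B k (w k)] =
  (\prod_(k < n) @coin_weight R (B k))%:E.
Proof.
rewrite /coin_prob /= /distribution /pushforward /unit_interval_prob /mrestr.
have := @dyadic_cylinder_measure R n 0 0 B.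
rewrite expr0 add0r mul1r setIC => <- //.
by move=> x _; rewrite /= expr0 mul1r subr0.
Qed.

Lemma coins_measure_unique (m1 m2 : {measure set coins -> \bar R}) :
  (m1 setT < +oo)%E -> (forall A, cylinders A -> m1 A = m2 A) ->
  forall A, measurable A -> m1 A = m2 A.
Proof.
move=> m1oo m12 A mA.
apply: (@measure_unique _ R coins cylinders (fun=> setT)) => //.
- exact: cylinders_setI.
- by move=> _; exists 0%N, (fun _ _ => true); apply/seteqP; split.
- by apply/seteqP; split => // x _; exists 0%N.
Qed.

Definition evens (w : coins) : coins := fun k => w k.*2.
Definition odds (w : coins) : coins := fun k => w k.*2.+1.

Lemma measurable_evens : measurable_fun setT evens.
Proof. by apply: measurable_into_coins => k b; exact: measurable_coin. Qed.

Lemma measurable_odds : measurable_fun setT odds.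
Proof. by apply: measurable_into_coins => k b; exact: measurable_coin. Qed.

HB.instance Definition _ := isMeasurableFun.Build _ _ _ _ evens measurable_evens.
HB.instance Definition _ := isMeasurableFun.Build _ _ _ _ odds measurable_odds.

(** The constraints on the even and on the odd places interleave into those
    of one cylinder. *)
Lemma coin_prob_split_cylinder A C : cylinders A -> cylinders C ->
  coin_prob (evens @^-1` A `&` odds @^-1` C) = (coin_prob A * coin_prob C)%E.
Proof.
move=> [n [B ->]] [m [D ->]]; rewrite !coin_prob_cylinder -EFinM.
pose N := maxn n m.
pose F k := if odd k then (fun b => (k./2 < m)%N ==> D k./2 b)
            else (fun b => (k./2 < n)%N ==> B k./2 b).
rewrite (_ : _ `&` _ = [set w | forall k, (k < N.*2)%N -> F k (w k)]); last first.
  apply/seteqP; split=> w /=.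
    move=> [hB hD] k kN; rewrite /F -[in w k](odd_double_half k).
    case: (odd k) => /=; apply/implyP; last exact: hB.
    by rewrite add1n; exact: hD.
  move=> h; split=> k kn.
    have := h k.*2; rewrite ltn_double leq_max kn => /(_ isT).
    by rewrite /F odd_double doubleK kn.
  have := h k.*2.+1; rewrite ltn_Sdouble leq_max kn orbT => /(_ isT).
  by rewrite /F /= odd_double /= uphalf_double kn.
rewrite coin_prob_cylinder; congr EFin.
(* A shorter cylinder is one of length [N] with vacuous constraints. *)
have pad p (G : nat -> bool -> bool) : (p <= N)%N ->
    \prod_(k < p) @coin_weight R (G k) =
    \prod_(k < N) @coin_weight R (fun b => (k < p)%N ==> G k b).
  move=> pN; rewrite (big_ord_widen _ (fun k => coin_weight (G k)) pN) big_mkcond /=.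
  apply: eq_bigr => k _; case: ifP => //= _; rewrite /coin_weight /=; lra.
rewrite (pad n) ?leq_maxl // (pad m) ?leq_maxr //.
elim: N {pad} => [|N IH]; first by rewrite !big_ord0 mulr1.
rewrite doubleS !big_ord_recr /= IH /F /= odd_double /= doubleK uphalf_double.
by ring.
Qed.

(** Uniqueness of measures, applied first with [C] a fixed cylinder and then
    with [A] a fixed measurable set. *)
Lemma splits_from_cylinders (P : probability coins R) :
  (forall A C, cylinders A -> cylinders C ->
     P (evens @^-1` A `&` odds @^-1` C) = (P A * P C)%E) ->
  forall A C, measurable A -> measurable C ->
    P (evens @^-1` A `&` odds @^-1` C) = (P A * P C)%E.
Proof.
move=> Pcyl.
have mE B : measurable B -> measurable (evens @^-1` B).
  by move=> mB; rewrite -[X in measurable X]setTI; exact: measurable_evens.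
have mO B : measurable B -> measurable (odds @^-1` B).
  by move=> mB; rewrite -[X in measurable X]setTI; exact: measurable_odds.
have cm B : cylinders B -> measurable (B : set coins) by exact: sub_sigma_algebra.
have finP B : (0 <= fine (P B))%R by rewrite fine_ge0.
have step C' : cylinders C' -> forall A', measurable A' ->
    P (evens @^-1` A' `&` odds @^-1` C') = (P A' * P C')%E.
  move=> cC A' mA'; have mC' := cm _ cC.
  pose m1 := image_measure (mrestr P (mO _ mC')) measurable_evens.
  pose m2 : {measure set coins -> \bar R} := mscale (NngNum (finP C')) P.
  have m2E B : m2 B = (P B * P C')%E.
    by rewrite /m2 /= /mscale /= fineK ?fin_num_measure 1?muleC.
  rewrite -m2E; transitivity (m1 A'); first by [].
  apply: coins_measure_unique => //.
    have -> : m1 setT = P (odds @^-1` C').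
      by rewrite /m1 /= /pushforward /mrestr preimage_setT setTI.
    by rewrite ltey_eq fin_num_measure //; exact: (mO _ mC').
  by move=> A0 cA0; rewrite m2E -Pcyl.
move=> A C mA mC.
pose m1 := image_measure (mrestr P (mE _ mA)) measurable_odds.
pose m2 : {measure set coins -> \bar R} := mscale (NngNum (finP A)) P.
have m2E B : m2 B = (P A * P B)%E.
  by rewrite /m2 /= /mscale /= fineK ?fin_num_measure.
rewrite -m2E setIC; transitivity (m1 C); first by [].
apply: coins_measure_unique => //.
  have -> : m1 setT = P (evens @^-1` A).
    by rewrite /m1 /= /pushforward /mrestr preimage_setT setTI.
  by rewrite ltey_eq fin_num_measure //; exact: (mE _ mA).
by move=> A0 cA0; rewrite m2E -step // setIC.
Qed.

(** One toss sequence thus carries two independent copies of itself, hence, by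
    iteration, countably many.  All independence below comes from here. *)
Lemma coin_prob_split A C : measurable A -> measurable C ->
  coin_prob (evens @^-1` A `&` odds @^-1` C) = (coin_prob A * coin_prob C)%E.
Proof. exact: splits_from_cylinders coin_prob_split_cylinder A C. Qed.

End coin_probability.

(** * A uniform variable, a Gumbel variable and samplers for finite laws *)

(** A quantity computed from finitely many measurable tests is discrete; this
    covers both the samplers and the argmax rules. *)
Lemma measurable_finite_tests d (T : measurableType d) (I : finType) (A : Type)
    (test : I -> T -> bool) (F : {ffun I -> bool} -> A) (a : A) :
  (forall i, measurable_fun setT (test i)) ->
  measurable [set w | F [ffun i => test i w] = a].
Proof.
move=> mt.
rewrite (_ : [set w | _] = \bigcup_(f in [set f | F f = a])
    \bigcap_(i in [set: I]) [set w | test i w = f i]).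
  apply: fin_bigcup_measurable => // f _; apply: fin_bigcap_measurable => // i _.
  by have := mt i measurableT [set f i]; rewrite setTI; exact.
apply/seteqP; split=> w /=.
  by move=> Fa; exists [ffun i => test i w] => // i _ /=; rewrite ffunE.
move=> [f /= <- fw]; congr F; apply/ffunP => i; rewrite ffunE; exact: fw.
Qed.

Section uniform_coin.
Context {R : realType}.
Local Notation mu := (@lebesgue_measure R).

Definition coin_value (w : coins) : R :=
  limn (series (fun k => (w k)%:R * 2^-1 ^+ k.+1 : R)).

Lemma is_cvg_coin_series (w : coins) :
  cvgn (series (fun k => (w k)%:R * 2^-1 ^+ k.+1 : R)).
Proof.
apply: (@series_le_cvg _ _ (geometric 2^-1 2^-1)) => [n|n|n|].
- by rewrite mulr_ge0 // exprn_ge0.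
- by rewrite mulr_ge0 // exprn_ge0.
- rewrite /geometric /= -exprS; case: (w n); rewrite ?mul1r // mul0r exprn_ge0 //.
- by apply: is_cvg_geometric_series; rewrite ger0_norm // invf_lt1 // ltr1n.
Qed.

Lemma measurable_coin_value : measurable_fun setT coin_value.
Proof.
apply: (@measurable_fun_cvg _ _ _ _
  (fun n w => series (fun k => ((w : coins) k)%:R * 2^-1 ^+ k.+1 : R) n)).
  move=> n; apply: measurable_sum => k; apply: measurable_funM => //.
  apply: (measurableT_comp (f := fun b : bool => b%:R : R)) => //.
  by apply: (measurable_fun_bool true); rewrite setTI; exact: measurable_coin.
by move=> w _; exact: is_cvg_coin_series.
Qed.

Lemma coin_value_digits (x : R) : 0 <= x < 1 -> coin_value (digits x) = x.
Proof.
move=> x01.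
have D01 n : 0 <= iter n doubling x < 1.
  elim: n => //= n; move: (iter n doubling x) => y /andP[y0 y1].
  by rewrite /doubling; case: (ltP y 2^-1) => y2; apply/andP; split; lra.
(* After [n] digits the error is [2^-n] times the [n]-fold doubling of [x]. *)
have partial n : series (fun k => (digits x k)%:R * 2^-1 ^+ k.+1 : R) n =
    x - 2^-1 ^+ n * iter n doubling x.
  elim: n => [|n IH]; first by rewrite /series /= big_nil expr0 mul1r subrr.
  rewrite /series /= big_nat_recr //= -[\sum_(_ <= _ < _) _]/(series _ n) IH.
  rewrite /digits /binary_digits /= {3}/doubling exprS ltNge.
  by case: (2^-1 <= _) => /=; field.
rewrite /coin_value (funext partial); apply/cvg_lim => //.
rewrite -[X in _ --> X]subr0; apply: cvgB; first exact: cvg_cst.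
apply: (@squeeze_cvgr _ _ _ _ (fun=> 0) (fun n => 2^-1 ^+ n)).
- near=> n; have /andP[h0 h1] := D01 n.
  by rewrite mulr_ge0 ?exprn_ge0 //= ler_piMr ?exprn_ge0 // ltW.
- exact: cvg_cst.
- by apply: cvg_expr; rewrite ger0_norm // invf_lt1 // ltr1n.
Unshelve. all: by end_near.
Qed.

Lemma coin_value_uniform (A : set R) : measurable A ->
  @coin_prob R (coin_value @^-1` A) = mu (A `&` `[0, 1[%classic).
Proof.
move=> mA; rewrite /coin_prob /= /distribution /pushforward.
rewrite /unit_interval_prob /mrestr; congr (mu _).
by apply/seteqP; split=> x /= [Ax x01]; split => //;
  move: Ax; rewrite coin_value_digits //; move: x01; rewrite in_itv.
Qed.

(** The inverse of the Gumbel distribution function at a uniform variable. *)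
Definition coin_gumbel (w : coins) : R := - ln (- ln (coin_value w)).

Lemma measurable_coin_gumbel : measurable_fun setT coin_gumbel.
Proof.
apply: measurableT_comp => //; apply: measurableT_comp => //.
apply: measurableT_comp => //; apply: measurableT_comp => //.
exact: measurable_coin_value.
Qed.

HB.instance Definition _ := isMeasurableFun.Build _ _ _ _
  coin_gumbel measurable_coin_gumbel.

Lemma coin_gumbelP : @is_gumbel R _ _ coin_prob coin_gumbel.
Proof.
move=> z; rewrite /cdf /distribution /pushforward.
pose A : set R := [set u | - ln (- ln u) <= z].
have mA : measurable A.
  rewrite -[X in measurable X]setTI.
  apply: measurable_fun_le => //.
  by do 4 (apply: measurableT_comp => //).
rewrite (_ : _ @^-1` _ = coin_value @^-1` A); last first.
  by apply/seteqP; split=> w /=; rewrite in_itv.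
rewrite coin_value_uniform //.
pose c := expR (- expR (- z)).
have c0 : 0 < c by exact: expR_gt0.
have c1 : c < 1 by rewrite -expR0 ltr_expR oppr_lt0 expR_gt0.
have key u : 0 < u < 1 -> (- ln (- ln u) <= z) = (u <= c).
  move=> /andP[u0 u1]; have lu : ln u < 0 by rewrite -ln1 ltr_ln ?posrE.
  rewrite lerNl -[- z]expRK ler_ln ?posrE ?expR_gt0 ?oppr_gt0 //.
  by rewrite lerNr -[- expR _]expRK ler_ln ?posrE ?expR_gt0.
(* On [0, 1[ the event is ]0, c], with or without the point 0, where [ln 0 = 0]. *)
apply/le_anti/andP; split.
  rewrite (_ : c%:E = mu `[0, c]%classic); last first.
    by rewrite lebesgue_measure_itv /= lte_fin c0 oppr0 adde0.
  apply: le_measure; rewrite ?inE //; first exact: measurableI.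
  move=> u [/= Au]; rewrite !in_itv /= => /andP[u0 u1]; rewrite u0 /=.
  have [u00|u00] := eqVneq u 0; first by rewrite u00 ltW.
  by rewrite -key // lt_neqAle eq_sym u00 u0.
rewrite (_ : c%:E = mu `]0, c]%classic); last first.
  by rewrite lebesgue_measure_itv /= lte_fin c0 oppr0 adde0.
apply: le_measure; rewrite ?inE //; first exact: measurableI.
move=> u /=; rewrite !in_itv /= => /andP[u0 uc].
by split; [rewrite /A /= key ?uc // u0 /= (le_lt_trans uc) |
  rewrite ltW //= (le_lt_trans uc)].
Qed.

Section sampler.
Variables (S : finType) (p : S -> R) (s0 : S).
Hypotheses (p_ge0 : forall s, 0 <= p s) (p_sum1 : \sum_s p s = 1).

Let cum (k : nat) : R := \sum_(j < #|S| | (j < k)%N) p (enum_val j).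

Let cum_le k l : (k <= l)%N -> cum k <= cum l.
Proof.
move=> kl; rewrite /cum [X in _ <= X](bigID (fun j : 'I__ => (j < k)%N)) /=.
rewrite [X in _ <= X + _](_ : _ = cum k); first by rewrite lerDl sumr_ge0.
apply: eq_bigl => j.
by case: (ltnP j k) => jk; rewrite ?andbF ?andbT // (leq_trans jk).
Qed.

Let cumS (k : 'I_#|S|) : cum k.+1 = cum k + p (enum_val k).
Proof.
rewrite /cum (bigD1 k) //= addrC; congr (_ + _); apply: eq_bigl => j.
by rewrite ltnS ltn_neqAle andbC.
Qed.

Let cumT : cum #|S| = 1.
Proof.
rewrite -p_sum1 [RHS](reindex (fun k : 'I_#|S| => enum_val k)) /=.
  by apply: eq_bigl => j; rewrite ltn_ord.
by exists enum_rank => ? _; rewrite ?enum_valK ?enum_rankK.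
Qed.

Let in_cell (k : 'I_#|S|) u := (cum k <= u) && (u < cum k.+1).

Let sample (f : {ffun 'I_#|S| -> bool}) : S :=
  if [pick k | f k] is Some k then enum_val k else s0.

(** Cut [0, 1[ into consecutive cells whose lengths are the prescribed
    probabilities, and read off the cell of the uniform variable. *)
Lemma finite_sampler : exists f : R -> S,
  (forall s, measurable (f @^-1` [set s])) /\
  (forall s, mu (f @^-1` [set s] `&` `[0, 1[%classic) = (p s)%:E).
Proof.
exists (fun u => sample [ffun k => in_cell k u]); split=> [s|s].
  apply: (@measurable_finite_tests _ R _ _ (fun k u => in_cell k u) sample) => k.
  by apply: measurable_and; [apply: measurable_fun_ler|apply: measurable_fun_ltr].
have cell_uniq k l u : in_cell k u -> in_cell l u -> k = l.
  move=> /andP[k1 k2] /andP[l1 l2]; apply/val_inj/eqP.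
  rewrite eqn_leq; apply/andP; split; rewrite leqNgt; apply/negP => h.
    by have := cum_le h; rewrite leNgt (le_lt_trans k1).
  by have := cum_le h; rewrite leNgt (le_lt_trans l1).
have cell_ex u : 0 <= u < 1 -> exists k, in_cell k u.
  move=> /andP[u0]; rewrite -cumT.
  have : (#|S| <= #|S|)%N by [].
  elim: {1 3}#|S| => [_|n IH nS un].
    by rewrite /cum big_pred0 ?ltNge ?u0 // => j; rewrite ltn0.
  have [un'|un'] := ltP u (cum n); first by apply: IH => //; exact: ltnW.
  by exists (Ordinal nS); rewrite /in_cell /= un' un.
rewrite (_ : _ `&` _ = `[cum (enum_rank s), cum (enum_rank s).+1[%classic).
  rewrite lebesgue_measure_itv /= lte_fin cumS enum_rankK ltrDl -EFinB.
  rewrite addrAC subrr add0r; case: ltP => // ps; congr EFin.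
  by apply/eqP; rewrite eq_le ps p_ge0.
have cell_le1 (k : 'I_#|S|) : cum k.+1 <= 1 by rewrite -cumT; exact: cum_le.
have cum_ge0 k : 0 <= cum k by apply: sumr_ge0.
apply/seteqP; split=> u /=; rewrite !in_itv /=.
  move=> [+ u01]; have [k ku] := cell_ex _ u01.
  rewrite /sample; case: pickP => [l|/(_ k)]; last by rewrite ffunE ku.
  by rewrite ffunE => lu <-; rewrite enum_valK.
move=> us; split; last first.
  by case/andP: us => u1 u2; rewrite (le_trans _ u1) //= (lt_le_trans u2).
rewrite /sample; case: pickP => [l|/(_ (enum_rank s))]; last by rewrite ffunE /in_cell us.
by rewrite ffunE => lu; rewrite (cell_uniq _ _ _ lu us) enum_rankK.
Qed.

End sampler.

End uniform_coin.

(** * Independent blocks of tosses *)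

Section coin_blocks.
Context {R : realType}.
Local Notation P := (@coin_prob R).

(** The [t]-th of infinitely many toss sequences: the even places of what
    remains after dropping the even places [t] times. *)
Definition block (t : nat) (w : coins) : coins := evens (iter t odds w).

Lemma measurable_iter_odds t : measurable_fun setT (iter t odds).
Proof.
elim: t => [|t IH] /=; first exact: measurable_id.
exact: (measurableT_comp (f := odds)).
Qed.

Lemma measurable_block t : measurable_fun setT (block t).
Proof. apply: (measurableT_comp (f := evens)) => //; exact: measurable_iter_odds. Qed.

Lemma preimage_measurable d d' (T : measurableType d) (T' : measurableType d')
  (f : T -> T') (A : set T') : measurable_fun setT f -> measurable A ->
  measurable (f @^-1` A).
Proof. by move=> mf mA; rewrite -[X in measurable X]setTI; exact: mf. Qed.

Lemma measurable_block_event t (C : nat -> set coins) :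
  (forall u, measurable (C u)) ->
  measurable [set w | forall u, (u < t)%N -> C u (block u w)].
Proof.
move=> mC.
rewrite (_ : [set w | _] = \bigcap_u (if (u < t)%N then block u @^-1` C u else setT)).
  apply: bigcapT_measurable => u; case: ifP => // _.
  apply: preimage_measurable => //; exact: measurable_block.
apply/seteqP; split=> w /= h u; first by move=> _; case: ifPn => // ut; exact: h.
by move=> ut; have := h u I; rewrite ut.
Qed.

(** Induction on [t]: block 0 lives on the even places and all later blocks on
    the odd ones. *)
Lemma coin_prob_blocks t (C : nat -> set coins) (D : set coins) :
  (forall u, measurable (C u)) -> measurable D ->
  P ([set w | forall u, (u < t)%N -> C u (block u w)] `&` iter t odds @^-1` D) =
  ((\prod_(u < t) fine (P (C u)))%:E * P D)%E.
Proof.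
move=> + mD; elim: t C => [|t IH] C mC.
  rewrite big_ord0 mul1e; congr (P _).
  by apply/seteqP; split=> w /=; [case|].
rewrite big_ord_recl EFinM -muleA -(IH (fun u => C u.+1)); last by move=> u; exact: mC.
rewrite fineK ?fin_num_measure // -coin_prob_split //; last first.
  apply: measurableI.
    by apply: (@measurable_block_event t (fun u => C u.+1)) => u; exact: mC.
  by apply: preimage_measurable => //; exact: measurable_iter_odds.
congr (P _); apply/seteqP; split=> w /=.
  move=> [h hD]; split; first exact: (h 0%N).
  split; last by rewrite -iterSr.
  by move=> u ut; have := h u.+1; rewrite /block iterSr; apply.
move=> [h0 [h hD]]; split; last by rewrite -iterS iterSr.
by move=> [|u] ut //; rewrite /block iterSr; exact: h.
Qed.

Lemma coin_prob_block t (D : set coins) : measurable D ->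
  P (block t @^-1` D) = P D.
Proof.
move=> mD; have := @coin_prob_blocks t (fun=> setT) (evens @^-1` D).
rewrite (_ : [set w | _] = setT) ?setTI; last by apply/seteqP; split.
rewrite big1 ?mul1e => [|u _]; last by rewrite probability_setT.
move=> -> //; last exact: preimage_measurable measurable_evens _.
have := @coin_prob_split R D setT mD measurableT.
by rewrite preimage_setT setIT probability_setT mule1.
Qed.

Lemma coin_prob_past_block t (C : nat -> set coins) (D : set coins) :
  (forall u, measurable (C u)) -> measurable D ->
  P ([set w | forall u, (u < t)%N -> C u (block u w)] `&` block t @^-1` D) =
  (P [set w | forall u, (u < t)%N -> C u (block u w)] * P D)%E.
Proof.
move=> mC mD.
have mE : measurable (evens @^-1` D) by exact: preimage_measurable measurable_evens _.
have := coin_prob_blocks t mC mE.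
have -> : iter t odds @^-1` (evens @^-1` D) = block t @^-1` D by [].
move=> ->; have := coin_prob_blocks t mC measurableT.
rewrite preimage_setT setIT probability_setT mule1 => ->; congr (_ * _)%E.
exact: (coin_prob_block 0 mD).
Qed.

(** A block is cut into blocks once more, one for each index. *)
Definition block_noise (I : finType) (i : I) (z : coins) : R :=
  coin_gumbel (block (enum_rank i) z).

Lemma measurable_block_noise (I : finType) (i : I) :
  measurable_fun setT (block_noise i).
Proof.
apply: (measurableT_comp (f := coin_gumbel)); first exact: measurable_coin_gumbel.
exact: measurable_block.
Qed.

HB.instance Definition _ (I : finType) (i : I) := isMeasurableFun.Build _ _ _ _
  (block_noise i) (measurable_block_noise i).

Lemma block_noiseE (I : finType) (i : I) (B : set R) : measurable B ->
  P (block_noise i @^-1` B) = P (coin_gumbel @^-1` B).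
Proof.
move=> mB; apply: (coin_prob_block (enum_rank i)).
by apply: preimage_measurable => //; exact: measurable_coin_gumbel.
Qed.

Lemma iid_block_noise (I : finType) :
  @iid_gumbel R _ _ P I (fun i => block_noise i).
Proof.
split=> [i z|B mB].
  rewrite -(coin_gumbelP z) /cdf /distribution /pushforward.
  exact: block_noiseE.
pose C u := if insub u is Some j then coin_gumbel @^-1` B (@enum_val I predT j) else setT.
have mC u : measurable (C u).
  rewrite /C; case: insubP => // j _ _.
  exact: (preimage_measurable (@measurable_coin_gumbel R) (mB _)).
have := coin_prob_blocks #|I| mC measurableT.
rewrite preimage_setT setIT probability_setT mule1.
rewrite (_ : [set w | _] = rect_event (fun i => block_noise i) B).
  move=> ->; congr EFin; rewrite [RHS](reindex (fun k : 'I_#|I| => enum_val k)) /=.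
    apply: eq_bigr => k _; rewrite /C valK; congr fine.
    by apply/esym/block_noiseE.
  by exists enum_rank => ? _; rewrite ?enum_valK ?enum_rankK.
apply/seteqP; split=> w /= h.
  by move=> i; have := h (enum_rank i) (ltn_ord _); rewrite /C valK enum_rankK.
move=> u un; rewrite /C insubT /=; have := h (enum_val (Ordinal un)).
by rewrite /block_noise enum_valK.
Qed.

End coin_blocks.

(** * Processes controlled by decision rules exist *)
Definition coordinate_events (R : realType) (A : finType) : set (set (A -> R)) :=
  [set C | exists (c : A) (U : set R), measurable U /\ C = [set e | U (e c)]].

Lemma measurable_coordinates (R : realType) (A : finType) d (T : measurableType d)
    (e : A -> T -> R) (D : set (A -> R)) :
  (forall a, measurable_fun setT (e a)) -> <<s @coordinate_events R A >> D ->
  measurable [set w | D (fun a => e a w)].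
Proof.
move=> me mD.
have mf : measurable_fun setT
    (fun w => (fun a => e a w) : g_sigma_algebraType (@coordinate_events R A)).
  apply: (@measurability _ _ T (g_sigma_algebraType (@coordinate_events R A)) setT _
    (@coordinate_events R A)) => //.
  move=> _ [_ [c [U [mU ->]]] <-]; exact: (me c).
exact: (preimage_measurable mf mD).
Qed.

Section construction.
Context {R : realType}.
Variables (M : mdp R) (psi : nat -> state M -> (action M -> R) -> action M).
Variables (s0 : state M) (F : state M -> action M -> R -> state M).
Hypothesis psiP : forall t, is_decision_rule (psi t).
Hypothesis mF : forall x b y, measurable (F x b @^-1` [set y]).
Hypothesis FE : forall x b y,
  lebesgue_measure (F x b @^-1` [set y] `&` `[0, 1[%classic) = (trans x b y)%:E.

Local Notation P := (@coin_prob R).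
Local Notation I := (state M * action M)%type.

(** The even half of block [t] drives the noise of time [t] and its odd half the
    transition, which are therefore independent. *)
Definition noise_at (t : nat) (i : I) (w : coins) : R :=
  block_noise i (evens (block t w)).

Lemma measurable_noise_at t i : measurable_fun setT (noise_at t i).
Proof.
apply: (measurableT_comp (f := block_noise i)); first exact: measurable_block_noise.
apply: (measurableT_comp (f := evens)); first exact: measurable_evens.
exact: measurable_block.
Qed.

HB.instance Definition _ t i := isMeasurableFun.Build _ _ _ _
  (noise_at t i) (measurable_noise_at t i).

Fixpoint state_at (t : nat) (w : coins) : state M :=
  if t is u.+1 then
    let x := state_at u w in
    F x (psi u x (fun a => noise_at u (x, a) w)) (coin_value (odds (block u w)))
  else s0.

Definition action_at (t : nat) (w : coins) : action M :=
  psi t (state_at t w) (fun a => noise_at t (state_at t w, a) w).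

Let choose t x b : set coins := [set z | psi t x (fun a => block_noise (x, a) z) = b].
Let jump x b y : set coins := coin_value @^-1` (F x b @^-1` [set y]).
Let rect (B : I -> set R) : set coins := rect_event (fun i => block_noise i) B.

Let m_choose t x b : measurable (choose t x b).
Proof.
apply: (measurable_coordinates (e := fun a => block_noise (x, a))
   (D := [set e | psi t x e = b])); first by move=> a; exact: measurable_block_noise.
exact: psiP.
Qed.

Let m_jump x b y : measurable (jump x b y).
Proof. exact: (preimage_measurable measurable_coin_value). Qed.

Let m_rect B : (forall i, measurable (B i)) -> measurable (rect B).
Proof.
move=> mB.
rewrite (_ : rect B = \bigcap_(i in [set: I]) (block_noise i @^-1` B i)).
  apply: fin_bigcap_measurable => // i _.
  by apply: preimage_measurable (mB i); exact: measurable_block_noise.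
by apply/seteqP; split=> w /= h i; [move=> _|]; exact: h.
Qed.

Let P_jump x b y : P (jump x b y) = (trans x b y)%:E.
Proof. by rewrite /jump coin_value_uniform. Qed.

Let m_ev A : measurable A -> measurable (evens @^-1` A : set coins).
Proof. exact: preimage_measurable measurable_evens. Qed.

Let m_od A : measurable A -> measurable (odds @^-1` A : set coins).
Proof. exact: preimage_measurable measurable_odds. Qed.

Let m_bl t A : measurable A -> measurable (block t @^-1` A).
Proof. exact: preimage_measurable (measurable_block t). Qed.

Let m_state t x : measurable (state_at t @^-1` [set x]).
Proof.
elim: t x => [|t IH] y /=.
  have [->|ne] := eqVneq s0 y.
    by rewrite (_ : _ @^-1` _ = setT) //; apply/seteqP; split.
  rewrite (_ : _ @^-1` _ = set0) //; apply/seteqP; split=> // w /=.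
  by move/eqP; rewrite (negbTE ne).
rewrite (_ : _ @^-1` _ = \bigcup_(i in [set: I]) (state_at t @^-1` [set i.1] `&`
    block t @^-1` (evens @^-1` choose t i.1 i.2 `&` odds @^-1` jump i.1 i.2 y))).
  apply: fin_bigcup_measurable => // i _; apply: measurableI => //.
  by apply: m_bl; apply: measurableI; [apply: m_ev; exact: m_choose|apply: m_od; exact: m_jump].
apply/seteqP; split=> w /=.
  by move=> h; exists (state_at t w, action_at t w).
move=> [[x b] _ /=[<- [cb]]]; rewrite /jump /= => <-.
by move: cb; rewrite /choose /= /noise_at => ->.
Qed.

Let m_action t b : measurable (action_at t @^-1` [set b]).
Proof.
rewrite (_ : _ @^-1` _ = \bigcup_(x in [set: state M]) (state_at t @^-1` [set x] `&`
    block t @^-1` (evens @^-1` choose t x b))).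
  apply: fin_bigcup_measurable => // x _; apply: measurableI => //.
  by apply: m_bl; apply: m_ev; exact: m_choose.
apply/seteqP; split=> w /=; first by move=> h; exists (state_at t w).
by move=> [x _ [<-]].
Qed.

Let step (x : nat -> state M) (b : nat -> action M) (B : nat -> I -> set R) u :=
  evens @^-1` (choose u (x u) (b u) `&` rect (B u)) `&`
  odds @^-1` jump (x u) (b u) (x u.+1).

Let m_step x b (B : nat -> I -> set R) : (forall u i, measurable (B u i)) ->
  forall u, measurable (step x b B u).
Proof.
move=> mB u; apply: measurableI; last by apply: m_od; exact: m_jump.
by apply: m_ev; apply: measurableI; [exact: m_choose|apply: m_rect; exact: mB].
Qed.

(** Once the path [x], [b] is fixed, what is required at time [u] depends on
    block [u] only: a path event is a rectangle in the independent blocks. *)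
Let noisy_pathE t x b B : x 0%N = s0 ->
  noisy_path_event state_at action_at noise_at t x b B =
  [set w | forall u, (u < t)%N -> step x b B u (block u w)].
Proof.
move=> x0; apply/seteqP; split=> w /=.
  move=> [[st h] hB] u ut; have [su au] := h _ ut.
  have suS : state_at u.+1 w = x u.+1.
    by move: (ut); rewrite leq_eqVlt => /orP[/eqP ->//|/h[]].
  split; last by move: suS; rewrite /= su -au /action_at su.
  split; last exact: (hB u ut).
  by move: au; rewrite /action_at su.
move=> h.
have sE u : (u <= t)%N -> state_at u w = x u.
  elim: u => [|u IH] ut; first by rewrite x0.
  have [[cu _]] := h u ut; rewrite /jump /= => <-; rewrite IH ?(ltnW ut) //.
  by move: cu; rewrite /choose /= /noise_at => ->.
split; [split; first exact: sE|] => u ut; last by have [[]] := h u ut.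
have := sE u (ltnW ut) => su; split => //.
by have [[cu _] _] := h u ut; rewrite /action_at su.
Qed.

Let noisy_path0 t x b B : x 0%N <> s0 ->
  noisy_path_event state_at action_at noise_at t x b B = set0.
Proof.
move=> x0; apply/seteqP; split=> // w [[st h] _] /=.
by case: t st h => [/=/esym//|t _ /(_ 0%N isT) [/esym]].
Qed.

Let noisy_path_block t x b B D :
  (forall u i, measurable (B u i)) -> measurable D ->
  P (noisy_path_event state_at action_at noise_at t x b B `&` block t @^-1` D) =
  (P (noisy_path_event state_at action_at noise_at t x b B) * P D)%E.
Proof.
move=> mB mD; have [x0|x0] := eqVneq (x 0%N) s0.
  rewrite noisy_pathE //; apply: coin_prob_past_block => //; exact: m_step.
by rewrite noisy_path0 ?set0I ?measure0 ?mul0e //; exact/eqP.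
Qed.

Let iid_noise_at t : iid_gumbel (fun i => noise_at t i : {RV P >-> R}).
Proof.
have E A : measurable A -> P (block t @^-1` (evens @^-1` A)) = P A.
  move=> mA; rewrite coin_prob_block; last exact: m_ev.
  exact: (coin_prob_block 0 mA).
have [gum iid] := @iid_block_noise R I.
split=> [i z|B mB].
  rewrite -(gum i z) /cdf /distribution /pushforward.
  apply: (E (block_noise i @^-1` `]-oo, z])).
  by apply: preimage_measurable => //; exact: measurable_block_noise.
have -> : rect_event (fun i => noise_at t i) B = block t @^-1` (evens @^-1` rect B) by [].
rewrite E; last exact: m_rect.
have Ei i : P (block_noise i @^-1` B i) = P (noise_at t i @^-1` B i).
  apply/esym; apply: (E (block_noise i @^-1` B i)).
  by apply: preimage_measurable (mB i); exact: measurable_block_noise.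
transitivity ((\prod_i fine (P (block_noise i @^-1` B i)))%:E).
  exact: (iid B mB).
apply: (congr1 EFin); apply: eq_bigr => i _.
exact: (congr1 fine (Ei i)).
Qed.

Lemma rule_process_coins :
  rule_process (P := P) psi s0 state_at action_at (fun t i => noise_at t i).
Proof.
split.
- by split.
- rewrite (_ : _ @^-1` _ = setT) ?probability_setT //.
  by apply/seteqP; split.
- split; first exact: iid_noise_at.
  move=> t x b B mB.
  have -> : rect_event (fun i => noise_at t i) (B t) =
      block t @^-1` (evens @^-1` rect (B t)) by [].
  have mD : measurable (evens @^-1` rect (B t)).
    by apply: m_ev; apply: m_rect; exact: mB.
  by rewrite (@noisy_path_block t x b B _ mB mD) (coin_prob_block t mD).
- by [].
- move=> t x b B mB.
  have EE A : measurable A -> P (evens @^-1` A) = P A.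
    by move=> mA; exact: (coin_prob_block 0 mA).
  have [x0|x0] := eqVneq (x 0%N) s0; last first.
    by rewrite !noisy_path0 ?set0I ?measure0 ?mul0e //; exact/eqP.
  have mC : measurable (choose t (x t) (b t) `&` rect (B t)).
    by apply: measurableI; [exact: m_choose|apply: m_rect; exact: mB].
  rewrite (_ : noisy_path_event _ _ _ t.+1 _ _ _ =
    noisy_path_event state_at action_at noise_at t x b B `&`
    block t @^-1` step x b B t); last first.
    rewrite !noisy_pathE //; apply/seteqP; split=> w /=.
      by move=> h; split; [move=> u ut; apply: h; exact: ltnW|exact: h].
    by move=> [h ht] u; rewrite ltnS leq_eqVlt => /orP[/eqP ->//|]; exact: h.
  rewrite (@noisy_path_block t x b B _ mB (m_step x b mB t)).
  rewrite (coin_prob_split mC (m_jump _ _ _)) P_jump muleA; congr (_ * _)%E.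
  rewrite -(EE _ mC) -(@noisy_path_block t x b B _ mB (m_ev mC)); congr (P _).
  apply/seteqP; split=> w /=.
    move=> [pw [cw rw]]; split; first by split.
    have [[sw _] _] := pw; by rewrite /action_at sw.
  move=> [[pw rw] aw]; split => //; split => //.
  have [[sw _] _] := pw; by move: aw; rewrite /action_at sw.
Qed.

End construction.

Lemma rule_process_exists (R : realType) (M : mdp R)
    (psi : nat -> state M -> (action M -> R) -> action M) (s0 : state M) :
  (forall t, is_decision_rule (psi t)) ->
  exists (d : measure_display) (T : measurableType d) (P : probability T R)
         (s_ : nat -> T -> state M) (a_ : nat -> T -> action M)
         (e_ : nat -> state M * action M -> {RV P >-> R}),
    rule_process psi s0 s_ a_ e_.
Proof.
move=> psiP.
have /choice[F hF] : forall i : state M * action M, exists f : R -> state M,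
    (forall s, measurable (f @^-1` [set s])) /\
    (forall s, lebesgue_measure (f @^-1` [set s] `&` `[0, 1[%classic) =
               (trans i.1 i.2 s)%:E).
  by move=> [x a]; apply: (finite_sampler s0); [exact: trans_ge0|exact: trans_sum1].
do 3 eexists; exists (state_at psi s0 (fun x a => F (x, a))),
  (action_at psi s0 (fun x a => F (x, a))), (fun t i => noise_at t i).
apply: rule_process_coins => // x b y; first exact: (hF (x, b)).1.
exact: (hF (x, b)).2.
Qed.

(** * Means under the Gumbel law *)
Lemma ray_measure_unique (R : realType) (m1 m2 : {measure set R -> \bar R}) :
  (m1 setT < +oo)%E -> (forall x, m1 `]x, +oo[%classic = m2 `]x, +oo[%classic) ->
  forall A, measurable A -> m1 A = m2 A.
Proof.
move=> m1oo m12 A mA.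
apply: (@measure_unique _ R R (@RGenOInfty.G R)
  (fun n => `](- n%:R : R), +oo[%classic) (RGenOInfty.measurableE R) _ _ _ m1 m2) => //.
- move=> _ _ [x ->] [y ->]; exists (Num.max x y).
  apply/seteqP; split=> z /=; rewrite !in_itv /= !andbT gt_max.
    by move=> [-> ->].
  by move=> /andP[].
- by move=> n; exists (- n%:R).
- rewrite -subTset => x _; exists (Num.trunc `|x|).+1 => //=.
  rewrite in_itv /= andbT ltrNl; apply: le_lt_trans (ler_norm _) _.
  by rewrite normrN truncnS_gt.
- by move=> _ [x ->].
- by move=> n; apply: le_lt_trans m1oo; apply: le_measure; rewrite ?inE.
Qed.

Section gumbel.
Context {R : realType}.
Local Notation P0 := (@coin_prob R).
Local Notation G := (@coin_gumbel R).
Local Notation law := (distribution P0 G).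

Definition gumbel_cdf (z : R) : R := expR (- expR (- z)).

Lemma gumbel_upper_tail (y : R) : 1 - gumbel_cdf y <= expR (- y).
Proof.
rewrite /gumbel_cdf; have := expR_ge1Dx (- expR (- y)); lra.
Qed.

Lemma gumbel_lower_tail (y : R) : gumbel_cdf (- y) <= expR (- y).
Proof.
rewrite /gumbel_cdf opprK ler_expR lerN2.
by have := expR_ge1Dx y; lra.
Qed.

(** As [n] grows: [y] is at most the number of natural numbers below it.
    Integrated, this bounds a mean by a series of tails. *)
Lemma le_sum_indic (y : R) n : 0 <= y ->
  Num.min y n%:R <= \sum_(0 <= k < n) ((k%:R < y)%R : nat)%:R.
Proof.
move=> y0; elim: n => [|n IH]; first by rewrite big_nil ge_min lexx orbT.
rewrite big_nat_recr //=; apply: le_trans (_ : Num.min y n%:R + ((n%:R < y)%R : nat)%:R <= _).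
  rewrite -natr1 !minEle; case: (ltP n%:R y) => ny; case: (leP y (n%:R + 1)) => ny' /=;
    lra.
by rewrite lerD2r.
Qed.

(** Both tails beyond [n] are at most [exp (- n)]. *)
Lemma gumbel_law_integrable : law.-integrable setT (fun y => y%:E).
Proof.
apply/integrableP; split; first exact/measurable_EFinP.
pose Bn (n : nat) : set R := [set y | n%:R < `|y|].
have mB n : measurable (Bn n).
  have mN : measurable_fun setT (fun y : R => `|y|) by exact: measurableT_comp.
  have mc : measurable_fun setT (fun y : R => n%:R : R) by exact: measurable_cst.
  by have := measurable_fun_ltr mc mN measurableT (Y := [set true]) I; rewrite setTI.
apply: (@le_lt_trans _ _ (\int[law]_y (\sum_(0 <= n <oo) (\1_(Bn n) y)%:E))%E).
  apply: ge0_le_integral => //.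
  - by do 2 apply: measurableT_comp => //; exact/measurable_EFinP.
  - apply: ge0_emeasurable_sum => [n y _ _|n _]; first by rewrite lee_fin.
    by apply/measurable_EFinP; exact: measurable_indic.
  move=> y _; pose N := (Num.trunc `|y|).+1.
  apply: le_trans (nneseries_lim_ge N _); last by move=> n _ _; rewrite lee_fin.
  rewrite sumEFin lee_fin; apply: (@le_trans _ _ (Num.min `|y| N%:R)).
    by rewrite le_min lexx ltW // /N truncnS_gt.
  apply: le_trans (le_sum_indic N (normr_ge0 y)) _.
  by apply: ler_sum => n _; rewrite indicE; case: ltP => h; rewrite // mem_set.
rewrite integral_nneseries //; last first.
  by move=> n; apply/measurable_EFinP; exact: measurable_indic.
have tail n : (\int[law]_y (\1_(Bn n) y)%:E <= (geometric 2 (expR (-1)) n)%:E)%E.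
  rewrite integral_indic // setIT.
  have cdfE z : law `]-oo, z]%classic = (gumbel_cdf z)%:E by exact: coin_gumbelP.
  have sub : Bn n `<=` `]-oo, (- n%:R : R)]%classic `|` ~` `]-oo, (n%:R : R)]%classic.
    move=> y; rewrite /Bn /= !in_itv /=.
    have [h|h] := leP y (- n%:R); first by left.
    by move=> ny; right; apply/negP; rewrite -ltNge; move: ny; rewrite ltr_normr; lra.
  apply: le_trans (le_measure law _ _ sub) _; rewrite ?inE //.
    by apply: measurableU => //; exact: measurableC.
  apply: le_trans (measureU2 _ _ _) _ => //; first exact: measurableC.
  have e1 := cdfE (- n%:R).
  have e2 : law (~` `]-oo, (n%:R : R)]%classic) = (1 - gumbel_cdf n%:R)%:E.
    by rewrite probability_setC // EFinB; congr (_ - _)%E; exact: cdfE.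
  apply: le_trans (leeD (_ : _ <= (gumbel_cdf (- n%:R))%:E)%E
      (_ : _ <= (1 - gumbel_cdf n%:R)%:E)%E) _;
    [by rewrite -e1|by rewrite -e2|].
  rewrite -EFinD lee_fin.
  have := gumbel_upper_tail n%:R; have := gumbel_lower_tail n%:R.
  have -> : expR (- n%:R) = expR (-1) ^+ n :> R by rewrite -expRM_natl mulrN1.
  by rewrite /geometric /=; lra.
apply: (@le_lt_trans _ _ (\sum_(0 <= n <oo) (geometric 2 (expR (-1)) n)%:E)%E).
  by apply: lee_nneseries => [n *|n *]; [apply: integral_ge0 => y _; rewrite lee_fin|exact: tail].
have cv : cvgn (series (geometric 2 (expR (-1)) : R^nat)).
  by apply: is_cvg_geometric_series; rewrite ger0_norm ?expR_ge0 //.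
rewrite (_ : (\sum_(0 <= n <oo) _)%E = limn (EFin \o series (geometric 2 (expR (-1)) : R^nat))).
  by rewrite EFin_lim // ltry.
by apply: congr_lim; apply/funext => n /=; rewrite /series /= sumEFin.
Qed.

(** The Euler-Mascheroni constant. *)
Definition gumbel_mean : R := fine (\int[law]_y y%:E)%E.

(** The image under [X] of the restriction of [P] to [E] agrees on rays with
    [P E] times the Gumbel law.  Restricting to [E], instead of conditioning on
    it, keeps null events [E] within the scope of the statement. *)
Lemma ge0_integral_gumbel_on_event d (T : measurableType d) (P : probability T R)
    (E : set T) (X : T -> R) (f : R -> \bar R) :
  measurable E -> measurable_fun setT X ->
  (forall z, P (E `&` [set w | X w <= z]) = (P E * (gumbel_cdf z)%:E)%E) ->
  measurable_fun setT f -> (forall y, 0 <= f y)%E ->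
  (\int[P]_(w in E) f (X w) = P E * \int[law]_y f y)%E.
Proof.
move=> mE mX XE mf f0.
have PE0 : 0 <= fine (P E) by rewrite fine_ge0.
have finE : P E \is a fin_num by rewrite fin_num_measure.
pose m1 := image_measure (mrestr P mE) mX.
pose m2 : {measure set R -> \bar R} := mscale (NngNum PE0) law.
have mle z : measurable [set w | X w <= z].
  have := mX measurableT `]-oo, z]%classic (measurable_itv _).
  by rewrite setTI; congr measurable; apply/seteqP; split=> w /=; rewrite in_itv.
have m12 A : measurable A -> m1 A = m2 A.
  apply: ray_measure_unique.
    have -> : m1 setT = P E by rewrite /m1 /= /pushforward /mrestr preimage_setT setTI.
    by rewrite ltey_eq finE.
  move=> z.
  have -> : m1 `]z, +oo[%classic = (P E - P (E `&` [set w | X w <= z]%R))%E.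
    rewrite -measureD ?ltey_eq ?finE //.
    rewrite /m1 /= /pushforward /mrestr; congr (P _).
    apply/seteqP; split=> w /=; rewrite in_itv /= andbT ltNge.
      by move=> [/negP nw Ew].
    by move=> [Ew /negP nw].
  have lawz : law `]z, +oo[%classic = (1 - gumbel_cdf z)%:E.
    rewrite -setCitvl probability_setC // EFinB; congr (_ - _)%E.
    exact: (@coin_gumbelP R z).
  transitivity ((fine (P E))%:E * (1 - gumbel_cdf z)%:E)%E; last first.
    by congr (_ * _)%E; rewrite -lawz.
  by rewrite XE -[P E]fineK // -!EFinM -EFinB; congr EFin; rewrite /=; ring.
transitivity (\int[mrestr P mE]_(w in E) f (X w))%E.
  apply: eq_measure_integral => A mA AE.
  by rewrite /= /mrestr (setIidl AE).
transitivity (\int[mrestr P mE]_w f (X w))%E.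
  rewrite [RHS](@ge0_negligible_integral _ _ _ _ setT (~` E)) //.
  - by rewrite setTD setCK.
  - exact: measurableC.
  - exact: (measurableT_comp mf mX).
  - by rewrite /= /mrestr setICl measure0.
transitivity (\int[m1]_y f y)%E.
  rewrite ge0_integral_pushforward // => y _; exact: f0.
transitivity (\int[m2]_y f y)%E.
  by apply: eq_measure_integral => A mA _; exact: m12.
by rewrite ge0_integral_mscale //= fineK.
Qed.

Lemma gumbel_on_event d (T : measurableType d) (P : probability T R)
    (E : set T) (X : T -> R) :
  measurable E -> measurable_fun setT X ->
  (forall z, P (E `&` [set w | X w <= z]) = (P E * (gumbel_cdf z)%:E)%E) ->
  P.-integrable E (fun w => (X w)%:E) /\
  (\int[P]_(w in E) (X w)%:E = P E * gumbel_mean%:E)%E.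
Proof.
move=> mE mX XE.
have finE : P E \is a fin_num by rewrite fin_num_measure.
have /integrableP[mid iid] := gumbel_law_integrable.
have mXE : measurable_fun E (fun w => (X w)%:E).
  by apply/measurable_EFinP; exact: measurable_funTS.
split.
  apply/integrableP; split => //.
  rewrite (@ge0_integral_gumbel_on_event _ _ _ _ _ (fun y => `|y%:E|)%E) //.
    by rewrite lte_mul_pinfty.
  by do 2 apply: measurableT_comp => //; exact/measurable_EFinP.
transitivity (\int[P]_(w in E) (EFin \o X) w)%E; first by [].
rewrite integralE funepos_comp funeneg_comp.
have mp : measurable_fun setT (EFin^\+ : R -> \bar R)%E by exact: measurable_funepos.
have mn : measurable_fun setT (EFin^\- : R -> \bar R)%E by exact: measurable_funeneg.
have hp := ge0_integral_gumbel_on_event mE mX XE mp (fun y => funepos_ge0 _ y).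
have hn := ge0_integral_gumbel_on_event mE mX XE mn (fun y => funeneg_ge0 _ y).
have ip := integrable_fin_num measurableT (integrable_funepos measurableT gumbel_law_integrable).
have ine := integrable_fin_num measurableT (integrable_funeneg measurableT gumbel_law_integrable).
rewrite /gumbel_mean (integralE law setT EFin).
apply: etrans (congr2 (fun a b => a - b)%E hp hn) _.
have arith (p a b : \bar R) : p \is a fin_num -> a \is a fin_num -> b \is a fin_num ->
    (p * a - p * b = p * (fine (a - b))%:E)%E.
  by case: p a b => [p||] // [a||] // [b||] // _ _ _; rewrite -!EFinM -EFinB /= mulrBr.
exact: arith.
Qed.

End gumbel.

(** * Log-sum-exp and the softmax *)
Section softmax.
Context {R : realType}.
Variables (A : finType) (a0 : A).
Implicit Types (c p : A -> R) (eta : R).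

(** The argmax is made a function of the finitely many comparisons of values;
    see [measurable_argmax]. *)
Definition argmax_of (test : {ffun A * A -> bool}) : A :=
  odflt a0 [pick a | [forall b, test (b, a)]].

Definition argmax c : A := argmax_of [ffun ba => c ba.1 <= c ba.2].

Lemma argmaxP c b : c b <= c (argmax c).
Proof.
rewrite /argmax /argmax_of; case: pickP => [a /forallP /(_ b)|]; first by rewrite ffunE.
have [a _ amax] := @arg_maxP _ _ A a0 predT c isT.
by move=> /(_ a) /negbT /negP[]; apply/forallP => b'; rewrite ffunE; exact: amax.
Qed.

(** Log-sum-exp at temperature [eta], extended by its limit at [eta = 0]. *)
Definition smax eta c : R :=
  if eta == 0 then c (argmax c) else eta * ln (\sum_a expR (c a / eta)).

Lemma sum_expR_gt0 (x : A -> R) : 0 < \sum_a expR (x a).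
Proof.
rewrite (bigD1 a0) //=; apply: ltr_pwDl; first exact: expR_gt0.
by apply: sumr_ge0 => a _; exact: expR_ge0.
Qed.

Lemma smax_mono eta c c' : 0 <= eta -> (forall a, c a <= c' a) -> smax eta c <= smax eta c'.
Proof.
rewrite le_eqVlt /smax eq_sym => /orP[/eqP ->|eta0] cc'.
  by rewrite eqxx (le_trans (cc' _)) // argmaxP.
rewrite gt_eqF // ler_pM2l // ler_ln ?posrE ?sum_expR_gt0 //.
by apply: ler_sum => a _; rewrite ler_expR ler_pM2r ?invr_gt0.
Qed.

Lemma smaxD eta c k : 0 <= eta -> smax eta (fun a => c a + k) = smax eta c + k.
Proof.
rewrite le_eqVlt /smax eq_sym => /orP[/eqP ->|eta0].
  rewrite eqxx; have -> // : argmax (fun a => c a + k) = argmax c.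
  by rewrite /argmax; congr argmax_of; apply/ffunP => ba; rewrite !ffunE lerD2r.
rewrite gt_eqF //.
under eq_bigr do rewrite mulrDl expRD.
rewrite -mulr_suml lnM ?posrE ?sum_expR_gt0 ?expR_gt0 // expRK mulrDr.
by rewrite mulrCA divff ?mulr1 // gt_eqF.
Qed.

Definition softmax eta c (a : A) : R :=
  if eta == 0 then (a == argmax c)%:R else expR ((c a - smax eta c) / eta).

Lemma softmax_ge0 eta c a : 0 <= softmax eta c a.
Proof. by rewrite /softmax; case: ifP => // _; exact: expR_ge0. Qed.

Lemma expR_smax eta c : 0 < eta -> expR (smax eta c / eta) = \sum_a expR (c a / eta).
Proof.
move=> eta0; rewrite /smax gt_eqF // mulrC mulKf ?gt_eqF //.
by rewrite lnK // posrE sum_expR_gt0.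
Qed.

Lemma softmaxE eta c a : 0 < eta ->
  softmax eta c a = expR (c a / eta) / \sum_b expR (c b / eta).
Proof.
by move=> eta0; rewrite /softmax gt_eqF // mulrBl expRD expRN expR_smax.
Qed.

Lemma softmax_sum1 eta c : 0 <= eta -> \sum_a softmax eta c a = 1.
Proof.
rewrite le_eqVlt eq_sym => /orP[/eqP ->|eta0].
  rewrite /softmax eqxx (bigD1 (argmax c)) //= eqxx big1 ?addr0 // => a.
  by move=> /negbTE ->.
under eq_bigr do rewrite softmaxE //.
by rewrite -mulr_suml mulfV // gt_eqF // sum_expR_gt0.
Qed.

(** The gap is [eta] times the relative entropy of [p] with respect to the
    softmax, which is nonnegative because [ln x <= x - 1]. *)
Lemma gibbs_inequality eta c p : 0 <= eta -> (forall a, 0 <= p a) -> \sum_a p a = 1 ->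
  \sum_a p a * c a + entropy_bonus eta p <= smax eta c.
Proof.
move=> eta_ge0 p0 p1; rewrite /entropy_bonus.
rewrite -[X in _ <= X]mulr1 -p1 mulr_sumr mulr_sumr -big_split /=.
move: eta_ge0; rewrite le_eqVlt eq_sym => /orP[/eqP ->|eta0].
  apply: ler_sum => a _; rewrite oppr0 mul0r addr0 /smax eqxx mulrC.
  by rewrite ler_wpM2r ?argmaxP.
rewrite -subr_ge0 -sumrB.
have pt a : eta * (p a - softmax eta c a) <=
    smax eta c * p a - (p a * c a + - eta * (p a * ln (p a))).
  have [pa|pa] := eqVneq (p a) 0.
    rewrite pa !mul0r !mulr0 addr0 subr0 sub0r mulrN oppr_le0.
    by rewrite mulr_ge0 ?softmax_ge0 // ltW.
  have pa0 : 0 < p a by rewrite lt_neqAle eq_sym pa p0.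
  have q0 : 0 < softmax eta c a by rewrite /softmax gt_eqF // expR_gt0.
  have ln_q : ln (softmax eta c a) = (c a - smax eta c) / eta.
    by rewrite /softmax gt_eqF // expRK.
  have cE : c a = smax eta c + eta * ln (softmax eta c a).
    by rewrite ln_q mulrCA divff ?gt_eqF // mulr1 addrC subrK.
  have h : ln (softmax eta c a / p a) <= softmax eta c a / p a - 1.
    have := @le_ln1Dx R (softmax eta c a / p a - 1).
    by rewrite addrCA subrr addr0; apply; rewrite ltrBrDl subrr divr_gt0.
  rewrite ln_div ?posrE // in h.
  have h2 : p a * (ln (softmax eta c a) - ln (p a)) <= softmax eta c a - p a.
    apply: le_trans (ler_wpM2l (ltW pa0) h) _.
    by rewrite mulrBr mulr1 mulrCA divff ?mulr1.
  have := ler_wpM2l (ltW eta0) h2; rewrite [in X in _ -> X]cE; lra.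
apply: le_trans (ler_sum _ (fun a _ => pt a)).
by rewrite -mulr_sumr sumrB p1 softmax_sum1 ?subrr ?mulr0 // ltW.
Qed.

Lemma gibbs_equality eta c : 0 <= eta ->
  \sum_a softmax eta c a * c a + entropy_bonus eta (softmax eta c) = smax eta c.
Proof.
move=> eta_ge0; rewrite /entropy_bonus.
move: (eta_ge0); rewrite le_eqVlt eq_sym => /orP[/eqP ->|eta0].
  rewrite oppr0 mul0r addr0 /softmax /smax eqxx (bigD1 (argmax c)) //= eqxx mul1r.
  by rewrite big1 ?addr0 // => a /negbTE ->; rewrite mul0r.
rewrite mulr_sumr -big_split /= -[RHS]mulr1 -(softmax_sum1 c eta_ge0) mulr_sumr.
apply: eq_bigr => a _; rewrite {2 3}/softmax gt_eqF // expRK.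
by rewrite -/(softmax eta c a) /softmax gt_eqF //; field; rewrite gt_eqF.
Qed.

End softmax.

(** The pointwise supremum of the functions [V <= F V] below [hi] is again one
    of them, and so is its image under [F]. *)
Lemma knaster_tarski_fixpoint (R : realType) (S : finType)
    (F : (S -> R) -> S -> R) (lo hi : R) :
  (forall V W, (forall s, V s <= W s) -> forall s, F V s <= F W s) ->
  lo <= hi -> (forall s, lo <= F (fun=> lo) s) -> (forall s, F (fun=> hi) s <= hi) ->
  exists V, forall s, V s = F V s.
Proof.
move=> Fmono lohi Flo Fhi.
pose sub := [set V : S -> R | (forall s, V s <= F V s) /\ (forall s, V s <= hi)].
pose V s := sup [set V s | V in sub].
have sub_sup s : has_sup [set V s | V in sub].
  split; first by exists lo, (fun=> lo).
  by exists hi => _ [W [_ Whi] <-].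
have V_ub W : sub W -> forall s, W s <= V s.
  by move=> subW s; apply: ub_le_sup; [exact: (sub_sup s).2|exists W].
have V_lub s k : (forall W, sub W -> W s <= k) -> V s <= k.
  by move=> h; apply: ge_sup; [exact: (sub_sup s).1|move=> _ [W sW <-]; exact: h].
have VF s : V s <= F V s.
  apply: V_lub => W sW; apply: le_trans (sW.1 s) _.
  by apply: Fmono; exact: V_ub.
exists V => s; apply/le_anti; rewrite VF /=; apply: V_ub; split; first exact: Fmono.
move=> s'; apply: le_trans (Fhi s'); apply: Fmono => s''.
by apply: V_lub => W sW; exact: sW.2.
Qed.

(** A line through the origin that stays below [k -> s * (expR k - 1)] is its
    tangent at 0, of slope [s]. *)
Lemma tangent_slope (R : realType) (p s : R) : 0 <= s -> 0 <= p ->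
  (forall k, k * p <= s * (expR k - 1)) -> p = s.
Proof.
move=> s0 p0 h; apply/le_anti/andP; split; rewrite leNgt; apply/negP => ps.
  (* chosen so that [p * (1 - k)] is the midpoint of [p] and [s] *)
  pose k := (p - s) / (2 * p).
  have pp : 0 < p by lra.
  have k0 : 0 < k by rewrite divr_gt0 ?subr_gt0 ?mulr_gt0.
  have kp : k * p = (p - s) / 2 by rewrite /k; field; rewrite gt_eqF.
  have k1 : k <= 2^-1.
    rewrite /k ler_pdivrMr ?mulr_gt0 //; lra.
  have e1 : expR k * (1 - k) <= 1.
    rewrite -[X in _ <= X](expRxMexpNx_1 k) ler_pM2l ?expR_gt0 //.
    exact: expR_ge1Dx.
  have e2 : (expR k - 1) * (1 - k) <= k by lra.
  have e3 := h k.
  have e4 : k * p * (1 - k) <= s * k.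
    apply: (@le_trans _ _ (s * (expR k - 1) * (1 - k))).
      by rewrite ler_wpM2r //; lra.
    by rewrite -mulrA ler_wpM2l.
  have e5 : p * (1 - k) <= s by rewrite -(ler_pM2l k0) mulrA [X in _ <= X]mulrC.
  lra.
(* chosen so that [p * (1 + j)] is at most the midpoint of [p] and [s] *)
pose j := (s - p) / (2 * s).
have ss : 0 < s by lra.
have j0 : 0 < j by rewrite divr_gt0 ?subr_gt0 ?mulr_gt0.
have js : j * s = (s - p) / 2 by rewrite /j; field; rewrite gt_eqF.
have e2 : expR (- j) * (1 + j) <= 1.
  rewrite -[X in _ <= X](expRxMexpNx_1 (- j)) opprK ler_pM2l ?expR_gt0 //.
  exact: expR_ge1Dx.
have e3 := h (- j).
have e4 : s * j <= j * p * (1 + j).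
  have : s * ((expR (- j) - 1) * (1 + j)) <= s * (- j).
    by rewrite ler_pM2l //; lra.
  have : - j * p * (1 + j) <= s * (expR (- j) - 1) * (1 + j).
    by rewrite ler_pM2r //; lra.
  by rewrite -mulrA; lra.
have e5 : s <= p * (1 + j) by rewrite -(ler_pM2l j0) mulrA mulrC.
have e6 : p * j <= s * j by rewrite ler_wpM2r // ltW.
lra.
Qed.

(** * The maximum of values perturbed by Gumbel noise *)

(** Given [E], the [e a] are independent Gumbel variables.  Rays suffice, and
    multiplying by [P E] includes the case of a null event. *)
Definition gumbel_vector_on (R : realType) d (T : measurableType d)
    (P : probability T R) (A : finType) (E : set T) (e : A -> T -> R) : Prop :=
  forall z : A -> R, P (E `&` [set w | forall a, e a w <= z a]) =
    (P E * (\prod_a gumbel_cdf (z a))%:E)%E.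

Section gumbel_max.
Context {R : realType} d (T : measurableType d) (P : probability T R).
Variables (A : finType) (a0 : A) (E : set T) (e : A -> T -> R) (eta : R).
Hypotheses (mE : measurable E) (me : forall a, measurable_fun setT (e a)).
Hypotheses (eE : gumbel_vector_on P E e) (eta_ge0 : 0 <= eta).

Definition is_max_of (c : A -> R) (Z : T -> R) :=
  (forall w a, c a + eta * e a w <= Z w) /\
  (forall w, exists a, Z w = c a + eta * e a w).

Lemma max_leP c Z w z : is_max_of c Z ->
  Z w <= z <-> forall a, c a + eta * e a w <= z.
Proof.
move=> [Zub Zat]; split=> [Zz a|h]; first exact: le_trans (Zub w a) Zz.
by have [a ->] := Zat w.
Qed.

Lemma measurable_max c Z : is_max_of c Z -> measurable_fun setT Z.
Proof.
move=> maxZ.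
apply: (@measurability _ _ T R setT Z (@RGenOInfty.G R) (RGenOInfty.measurableE R)).
move=> _ [_ [z ->] <-]; rewrite setTI.
rewrite (_ : Z @^-1` _ =
    \bigcup_(a in [set: A]) (fun w => c a + eta * e a w) @^-1` `]z, +oo[%classic).
  apply: fin_bigcup_measurable => // a _.
  apply: (@preimage_measurable _ _ T R) (measurable_itv _).
  by apply: measurable_funD => //; apply: measurable_funM.
apply/seteqP; split=> w /=.
  rewrite in_itv /= andbT; have [a ->] := maxZ.2 w => za.
  by exists a => //=; rewrite in_itv /= andbT.
move=> [a _] /=; rewrite !in_itv /= !andbT => za.
exact: lt_le_trans za (maxZ.1 w a).
Qed.

(** Max-stability: in the product of the distribution functions the exponents
    add up to a log-sum-exp, so the maximum is [eta] times a Gumbel variable,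
    shifted by [smax]. *)
Lemma integral_gumbel_max c Z : is_max_of c Z ->
  P.-integrable E (fun w => (Z w)%:E) /\
  (\int[P]_(w in E) (Z w)%:E = P E * (smax a0 eta c + eta * gumbel_mean)%:E)%E.
Proof.
move=> maxZ; have mZ := measurable_max maxZ.
have finE : P E \is a fin_num by rewrite fin_num_measure.
have PEoo : (P E < +oo)%E by rewrite ltey_eq finE.
have cst_int (k : R) : P.-integrable E (fun=> k%:E).
  exact: (finite_measure_integrable_cst P k mE).
have cst_val (k : R) : (\int[P]_(w in E) k%:E = P E * k%:E)%E.
  by rewrite integral_cst // muleC.
have [eta0|eta0] := eqVneq eta 0.
  have -> : (fun w => (Z w)%:E) = (fun=> (smax a0 eta c)%:E).
    apply/funext => w; congr EFin; rewrite /smax eta0 eqxx; apply/le_anti/andP; split.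
      have [a ->] := maxZ.2 w; rewrite eta0 mul0r addr0; exact: argmaxP.
    by have := maxZ.1 w (argmax a0 c); rewrite eta0 mul0r addr0.
  by split; [exact: cst_int|rewrite cst_val eta0 mul0r addr0].
have eta_gt0 : 0 < eta by rewrite lt_neqAle eq_sym eta0.
pose L := smax a0 eta c.
pose X w := (Z w - L) / eta.
have mX : measurable_fun setT X by apply: measurable_funM => //; exact: measurable_funB.
have XE z : P (E `&` [set w | X w <= z]) = (P E * (gumbel_cdf z)%:E)%E.
  rewrite (_ : [set w | X w <= z] =
      [set w | forall a, e a w <= (eta * z + L - c a) / eta]); last first.
    apply/seteqP; split=> w /=.
      rewrite /X ler_pdivrMr // lerBlDr => /(max_leP _ _ maxZ) h a.
      by rewrite ler_pdivlMr // lerBrDl [e a w * _]mulrC (mulrC eta z).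
    move=> h; rewrite /X ler_pdivrMr // lerBlDr; apply/(max_leP _ _ maxZ) => a.
    by have := h a; rewrite ler_pdivlMr // lerBrDl [e a w * _]mulrC (mulrC eta z).
  rewrite eE; congr (_ * _%:E)%E; rewrite /gumbel_cdf -expR_sum sumrN.
  congr (expR (- _)).
  have term a : expR (- ((eta * z + L - c a) / eta)) =
      expR (- z) / expR (L / eta) * expR (c a / eta).
    rewrite -expRN -!expRD; congr expR; field; exact: eta0.
  under eq_bigr do rewrite term.
  rewrite -mulr_sumr /L expR_smax // divfK //.
  by rewrite gt_eqF // (sum_expR_gt0 a0 (fun a => c a / eta)).
have [intX valX] := gumbel_on_event mE mX XE.
have ZE : (fun w => (Z w)%:E) = (fun w => (eta%:E * (X w)%:E + L%:E)%E).
  by apply/funext => w; rewrite -EFinM -EFinD; congr EFin; rewrite /X; field.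
rewrite ZE; split.
  by apply: integrableD => //; exact: integrableZl.
rewrite integralD //; last exact: integrableZl.
rewrite integralZl // valX cst_val -/L.
by rewrite -[P E]fineK // -!EFinM -EFinD; congr EFin; ring.
Qed.

(** Raising the value of [a] by [h] raises the mean of the maximum by at least
    [h] times the probability of choosing [a], since the old choice remains
    available.  That probability is thus a subgradient of [smax], which is
    differentiable with the softmax as its gradient, however ties are broken. *)
Lemma choice_probability c (psi : T -> A) :
  0 < eta ->
  (forall w a, c a + eta * e a w <= c (psi w) + eta * e (psi w) w) ->
  (forall a, measurable (psi @^-1` [set a])) ->
  forall a, P (E `&` psi @^-1` [set a]) = (P E * (softmax a0 eta c a)%:E)%E.
Proof.
move=> eta0 psimax mpsi a.
have finE : P E \is a fin_num by rewrite fin_num_measure.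
have mEa : measurable (E `&` psi @^-1` [set a]) by exact: measurableI.
have finEa : P (E `&` psi @^-1` [set a]) \is a fin_num by rewrite fin_num_measure.
pose Z w := c (psi w) + eta * e (psi w) w.
have maxZ : is_max_of c Z by split=> [//|w]; exists (psi w).
have [intZ valZ] := integral_gumbel_max maxZ.
pose q := fine (P E); pose p := fine (P (E `&` psi @^-1` [set a])).
have slope h : h * p <= q * (smax a0 eta (fun b => c b + h * (b == a)%:R) - smax a0 eta c).
  pose c' b := c b + h * (b == a)%:R.
  pose Z' w := c' (argmax a0 (fun b => c' b + eta * e b w))
                + eta * e (argmax a0 (fun b => c' b + eta * e b w)) w.
  have maxZ' : is_max_of c' Z'.
    split=> w; last by exists (argmax a0 (fun b => c' b + eta * e b w)).
    by move=> b; exact: (argmaxP a0 (fun b => c' b + eta * e b w)).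
  have [intZ' valZ'] := integral_gumbel_max maxZ'.
  have intI : P.-integrable E (fun w => (h * \1_(psi @^-1` [set a]) w)%:E).
    under eq_fun do rewrite EFinM.
    apply: integrableZl => //.
    exact: (integrableS measurableT mE (@subsetT _ _) (integrable_indic P (mpsi a))).
  have : (\int[P]_(w in E) ((Z w)%:E + (h * \1_(psi @^-1` [set a]) w)%:E) <=
          \int[P]_(w in E) (Z' w)%:E)%E.
    apply: le_integral => //; first exact: integrableD.
    move=> w _; rewrite -EFinD lee_fin.
    apply: le_trans (maxZ'.1 w (psi w)).
    rewrite /Z /c' addrAC lerD2r lerD2l indicE; case: (eqVneq (psi w) a) => pw.
      by rewrite mem_set.
    by rewrite memNset //= => /eqP; rewrite (negbTE pw).
  have qE : P E = q%:E by rewrite /q fineK.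
  have valI : (\int[P]_(w in E) (h * \1_(psi @^-1` [set a]) w)%:E = (h * p)%:E)%E.
    under eq_integral do rewrite EFinM.
    rewrite integralZl //; last first.
      exact: (integrableS measurableT mE (@subsetT _ _) (integrable_indic P (mpsi a))).
    by rewrite integral_indic // setIC EFinM /p fineK.
  rewrite integralD // valZ valZ' valI qE.
  rewrite -!EFinM -EFinD lee_fin -/c'; lra.
have S0 := sum_expR_gt0 a0 (fun b => c b / eta).
have p_ge0 : 0 <= p by rewrite fine_ge0.
have q_ge0 : 0 <= q by rewrite fine_ge0.
have tangent k : k * p <= q * softmax a0 eta c a * (expR k - 1).
  have := slope (eta * k).
  pose c' b := c b + eta * k * (b == a)%:R.
  have S0' := sum_expR_gt0 a0 (fun b => c' b / eta).
  have SE : \sum_b expR (c' b / eta) =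
      (\sum_b expR (c b / eta)) * (1 + softmax a0 eta c a * (expR k - 1)).
    have sS : (\sum_b expR (c b / eta)) * softmax a0 eta c a = expR (c a / eta).
      by rewrite softmaxE // mulrCA mulfV ?mulr1 // gt_eqF.
    rewrite mulrDr mulr1 mulrA sS (bigD1 a) //= [in RHS](bigD1 a) //=.
    rewrite {1}/c' eqxx mulr1 mulrDl expRD (mulrC eta k) mulfK ?gt_eqF //.
    have -> : \sum_(b | b != a) expR (c' b / eta) = \sum_(b | b != a) expR (c b / eta).
      by apply: eq_bigr => b /negbTE ba; rewrite /c' ba mulr0 addr0.
    by ring.
  have pos : 0 < 1 + softmax a0 eta c a * (expR k - 1) by rewrite -(pmulr_rgt0 _ S0) -SE.
  have ln_le : ln (1 + softmax a0 eta c a * (expR k - 1)) <= softmax a0 eta c a * (expR k - 1).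
    by apply: le_ln1Dx; rewrite -subr_gt0 opprK addrC.
  rewrite /smax gt_eqF // -/c' SE lnM ?posrE //.
  set l := ln (1 + _) in ln_le *; move=> h.
  have : eta * (k * p) <= eta * (q * l) by lra.
  rewrite ler_pM2l // => h'; apply: le_trans h' _.
  by rewrite -mulrA ler_wpM2l.
have pE : p = q * softmax a0 eta c a.
  by apply: tangent_slope => //; rewrite mulr_ge0 ?softmax_ge0.
by rewrite -[LHS]fineK // -/p pE EFinM fineK.
Qed.

End gumbel_max.

(** * Means of discounted sums *)

(** The sequence converges where its upper and lower limits agree and are
    finite; elsewhere [limn] is a default constant. *)
Lemma measurable_limn (R : realType) d (T : measurableType d) (u : nat -> T -> R) :
  (forall n, measurable_fun setT (u n)) ->
  measurable_fun setT (fun w => limn (fun n => u n w)).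
Proof.
move=> mu.
pose U n w := (u n w)%:E.
have mU n : measurable_fun setT (U n) by exact/measurable_EFinP.
pose sup w := limn_esup (fun n => U n w).
pose inf w := limn_einf (fun n => U n w).
have msup : measurable_fun setT sup by exact: measurable_fun_limn_esup.
have minf : measurable_fun setT inf.
  rewrite /inf /limn_einf; apply: measurableT_comp => //.
  apply: measurable_fun_limn_esup => n; exact: measurableT_comp.
rewrite (_ : (fun w => _) =
    fun w => if (inf w == sup w) && (sup w \is a fin_num) then fine (sup w) else point).
  apply: measurable_fun_ifT => //.
    apply: measurable_and; first exact: measurable_fun_eqe.
    by apply: (measurable_fun_bool true); apply: emeasurable_fin_num.
  exact: measurableT_comp.
apply/funext => w.
have [cv|ncv] := pselect (cvgn (fun n => u n w)).
  have cvE : U n w @[n --> \oo] --> (limn (fun n => u n w))%:E.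
    by apply: cvg_EFin => //; exact: nearW.
  have [i s] := cvg_limn_einf_sup cvE.
  by rewrite /inf /sup i s eqxx.
rewrite dvgP //; case: ifPn => // /andP[/eqP is_eq sfin]; exfalso; apply: ncv.
have cvE : U n w @[n --> \oo] --> sup w.
  apply: (@squeeze_cvge _ _ _ _ (einfs (fun n => U n w)) _ (esups (fun n => U n w))).
  - apply: nearW => n; apply/andP; split.
      by apply: ereal_inf_lbound; exists n => /=.
    by apply: ereal_sup_ubound; exists n => /=.
  - rewrite -is_eq /inf limn_einf_lim; exact: is_cvg_einfs.
  - rewrite /sup limn_esup_lim; exact: is_cvg_esups.
move: cvE; rewrite -(fineK sfin) => /fine_cvgP[_ cvf].
by apply/cvg_ex; exists (fine (sup w)).
Qed.

Lemma expectation_integral (R : realType) d (T : measurableType d)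
    (P : probability T R) (X : T -> R) : ('E_P[X] = \int[P]_w (X w)%:E)%E.
Proof. by rewrite unlock. Qed.

Section verification.
Context {R : realType} d (T : measurableType d) (P : probability T R).
Variables (gamma : R) (Y : nat -> T -> R) (v : nat -> R) (C D : R).
Hypotheses (gamma_ge0 : 0 <= gamma) (gamma_lt1 : gamma < 1).
Hypothesis mY : forall t, measurable_fun setT (Y t).
Hypothesis YC : forall t, (\int[P]_w `|Y t w|%:E <= C%:E)%E.
Hypothesis vD : forall t, `|v t| <= D.

Let iY t : P.-integrable setT (fun w => (Y t w)%:E).
Proof.
apply/integrableP; split; first exact/measurable_EFinP.
by apply: le_lt_trans (YC t) _; rewrite ltry.
Qed.

Let reward_mean t := fine (\int[P]_w (Y t w)%:E)%E.

Let partial n w := series (fun t => gamma ^+ t * Y t w) n.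

Let mpartial n : measurable_fun setT (partial n).
Proof. by apply: measurable_sum => t; apply: measurable_funM. Qed.

Let bound w : \bar R := (\sum_(0 <= t <oo) (gamma ^+ t * `|Y t w|)%:E)%E.

Let term_ge0 t w : (0 <= (gamma ^+ t * `|Y t w|)%:E)%E.
Proof. by rewrite lee_fin mulr_ge0 ?exprn_ge0. Qed.

Let mterm t : measurable_fun setT (fun w => (gamma ^+ t * `|Y t w|)%:E).
Proof.
by apply/measurable_EFinP; apply: measurable_funM => //; exact: measurableT_comp.
Qed.

Let bound_ge0 w : (0 <= bound w)%E.
Proof. exact: nneseries_ge0. Qed.

Let ibound : P.-integrable setT bound.
Proof.
apply/integrableP; split; first by apply: ge0_emeasurable_sum.
under eq_integral do rewrite gee0_abs //.
rewrite integral_nneseries //.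
have C0 : 0 <= C.
  by rewrite -lee_fin; apply: le_trans (YC 0); apply: integral_ge0 => w _; rewrite lee_fin.
apply: (@le_lt_trans _ _ (\sum_(0 <= t <oo) (geometric C gamma t)%:E)%E).
  apply: lee_nneseries => [t *|t _]; first exact: integral_ge0.
  under eq_integral do rewrite EFinM.
  have mn : measurable_fun setT (fun w => (`|Y t w|)%:E).
    by apply/measurable_EFinP; exact: measurableT_comp.
  rewrite (ge0_integralZl P measurableT mn) ?lee_fin ?exprn_ge0 //.
  by rewrite /geometric /= mulrC EFinM lee_wpmul2l // lee_fin exprn_ge0.
have cv : cvgn (series (geometric C gamma : R^nat)).
  by apply: is_cvg_geometric_series; rewrite ger0_norm.
rewrite (_ : (\sum_(0 <= n <oo) _)%E = limn (EFin \o series (geometric C gamma : R^nat))).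
  by rewrite EFin_lim // ltry.
by apply: congr_lim; apply/funext => n /=; rewrite /series /= sumEFin.
Qed.

Let cvg_partial w : bound w \is a fin_num -> cvgn (fun n => partial n w).
Proof.
move=> bfin; apply: (@normed_cvg R R^o).
apply: nondecreasing_is_cvgn.
  apply: nondecreasing_series => t _ _; exact: normr_ge0.
exists (fine (bound w)) => _ [n _ <-].
rewrite -lee_fin fineK // /series /= -sumEFin.
apply: le_trans (nneseries_lim_ge n _) => //.
apply: lee_sum => t _; rewrite lee_fin normrM ger0_norm ?exprn_ge0 //.
Qed.

Let partial_le n w : (`|(partial n w)%:E| <= bound w)%E.
Proof.
apply: le_trans (nneseries_lim_ge n _) => //.
rewrite sumEFin lee_fin; apply: le_trans (ler_norm_sum _ _ _) _.
by apply: ler_sum => t _; rewrite normrM ger0_norm ?exprn_ge0.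
Qed.

Let partial_mean n : (\int[P]_w (partial n w)%:E =
  (\sum_(0 <= t < n) gamma ^+ t * reward_mean t)%:E)%E.
Proof.
rewrite /partial /series /=.
under eq_integral do rewrite -sumEFin.
rewrite integral_sum //; last first.
  by move=> t; under eq_fun do rewrite EFinM; exact: integrableZl.
rewrite -sumEFin; apply: eq_bigr => t _.
under eq_integral do rewrite EFinM.
by rewrite integralZl // EFinM fineK //; exact: integrable_fin_num.
Qed.

(** The partial sums are dominated by [bound], whose mean is at most
    [C / (1 - gamma)]; as [bound] is then finite almost everywhere, the series
    also converges almost everywhere. *)
Lemma cvg_discounted_means :
  (\sum_(0 <= t < n) gamma ^+ t * reward_mean t)%:E @[n --> \oo] -->
  ('E_P[fun w => discounted_sum gamma (fun t => Y t w)])%E.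
Proof.
have [] := @dominated_convergence _ _ _ P setT measurableT
  (fun n w => (partial n w)%:E)
  (fun w => (discounted_sum gamma (fun t => Y t w))%:E) bound.
- by move=> n; exact/measurable_EFinP.
- by apply/measurable_EFinP; exact: measurable_limn.
- have := integrable_ae measurableT ibound; apply: filterS => w /(_ I) bfin _.
  by apply: cvg_EFin; [exact: nearW|exact: cvg_partial].
- exact: ibound.
- by apply: aeW => w n _; exact: partial_le.
move=> _ _; rewrite expectation_integral.
by under eq_fun do rewrite partial_mean.
Qed.

Let cvg_discounted_v : gamma ^+ n * v n @[n --> \oo] --> (0 : R).
Proof.
have gD : gamma ^+ n * D @[n --> \oo] --> (0 : R).
  rewrite -[X in _ --> X](mul0r D); apply: cvgM; last exact: cvg_cst.
  by apply: cvg_expr; rewrite ger0_norm.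
apply: norm_cvg0; apply: (squeeze_cvgr _ (cvg_cst 0) gD); apply: nearW => n.
by rewrite normr_ge0 normrM ger0_norm ?exprn_ge0 // ler_wpM2l ?exprn_ge0.
Qed.

(** Weighted by [gamma ^+ t], the one-step inequalities telescope to
    [v 0 - gamma ^+ n * v n], and the [v n] are bounded. *)
Lemma verification_le :
  (forall t, reward_mean t + gamma * v t.+1 <= v t) ->
  ('E_P[fun w => discounted_sum gamma (fun t => Y t w)] <= (v 0%N)%:E)%E.
Proof.
move=> step.
have le n : \sum_(0 <= t < n) gamma ^+ t * reward_mean t <= v 0%N - gamma ^+ n * v n.
  elim: n => [|n IH]; first by rewrite big_nil expr0 mul1r subrr.
  rewrite big_nat_recr //= exprSr.
  have := ler_wpM2l (exprn_ge0 n gamma_ge0) (step n); lra.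
have cv : (v 0%N - gamma ^+ n * v n)%:E @[n --> \oo] --> (v 0%N)%:E.
  apply: cvg_EFin; first exact: nearW.
  rewrite -[X in _ --> X]subr0; apply: cvgB; [exact: cvg_cst|exact: cvg_discounted_v].
apply: (lee_cvg_to cvg_discounted_means cv).
by apply: nearW => n; rewrite lee_fin.
Qed.

Lemma verification_eq :
  (forall t, reward_mean t + gamma * v t.+1 = v t) ->
  ('E_P[fun w => discounted_sum gamma (fun t => Y t w)] = (v 0%N)%:E)%E.
Proof.
move=> step.
have eq n : \sum_(0 <= t < n) gamma ^+ t * reward_mean t = v 0%N - gamma ^+ n * v n.
  elim: n => [|n IH]; first by rewrite big_nil expr0 mul1r subrr.
  rewrite big_nat_recr //= exprSr IH -(step n); ring.
have cv : (v 0%N - gamma ^+ n * v n)%:E @[n --> \oo] --> (v 0%N)%:E.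
  apply: cvg_EFin; first exact: nearW.
  rewrite -[X in _ --> X]subr0; apply: cvgB; [exact: cvg_cst|exact: cvg_discounted_v].
have := cvg_discounted_means; rewrite (funext (fun n => congr1 EFin (eq n))) => h.
exact: (cvg_unique _ h cv).
Qed.

End verification.

(** * Finite-valued variables and finite histories *)
Section finite_valued.
Context {R : realType} d (T : measurableType d) (P : probability T R).
Variables (K : finType) (H : T -> K).
Hypothesis mH : forall k, measurable (H @^-1` [set k]).

Lemma integral_partition (f : T -> R) : P.-integrable setT (fun w => (f w)%:E) ->
  (\int[P]_w (f w)%:E = \sum_k \int[P]_(w in H @^-1` [set k]) (f w)%:E)%E.
Proof.
move=> intf.
have covE : \big[setU/set0]_(k <- index_enum K) (H @^-1` [set k]) = setT.
  apply/seteqP; split=> // w _; rewrite -bigcup_seq; exists (H w) => //=.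
  exact: mem_index_enum.
rewrite -[X in integral _ X _]covE integral_bigsetU_EFin //.
- exact: index_enum_uniq.
- by move=> k l _ _ [w [/= -> ->]].
- rewrite covE; have /integrableP[] := intf => //.
Qed.

Lemma probability_partition (B : set T) : measurable B ->
  (P B = \sum_k P (H @^-1` [set k] `&` B))%E.
Proof.
move=> mB.
have := @integral_partition (\1_B) (integrable_indic P mB).
rewrite integral_indic // setIT => ->; apply: eq_bigr => k _.
by rewrite integral_indic // setIC.
Qed.

Lemma measurable_finite_valued (F : K -> T -> R) :
  (forall k, measurable_fun setT (F k)) -> measurable_fun setT (fun w => F (H w) w).
Proof.
move=> mF.
rewrite (_ : (fun w => _) = fun w => \sum_k \1_(H @^-1` [set k]) w * F k w).
  apply: measurable_sum => k; apply: measurable_funM; last exact: mF.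
  exact: (measurable_indic (mH k)).
apply/funext => w; rewrite (bigD1 (H w)) //= indicE mem_set // mul1r.
rewrite big1 ?addr0 // => k kH; rewrite indicE memNset ?mul0r //=.
by move=> /esym /eqP; rewrite (negbTE kH).
Qed.

Lemma integrable_finite_valued (F : K -> T -> R) :
  (forall k, P.-integrable setT (fun w => (F k w)%:E)) ->
  P.-integrable setT (fun w => (F (H w) w)%:E).
Proof.
move=> iF.
have iN k : P.-integrable setT (fun w => (`|F k w|)%:E).
  have := integrable_abse (iF k); exact.
apply: (@le_integrable _ _ _ _ _ measurableT _ (fun w => \sum_k (`|F k w|)%:E)%E).
- apply/measurable_EFinP; apply: measurable_finite_valued => k.
  by have /integrableP[/measurable_EFinP] := iF k.
- move=> w _; rewrite sumEFin lee_fin ler_normr; apply/orP; left.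
  by rewrite (bigD1 (H w)) //= lerDl sumr_ge0.
- exact: integrable_sum.
Qed.

Lemma integral_finite_valued (F : K -> R) :
  (\int[P]_w (F (H w))%:E = (\sum_k fine (P (H @^-1` [set k])) * F k)%:E)%E.
Proof.
rewrite (@integral_partition (fun w => F (H w))); last first.
  apply: (integrable_finite_valued (F := fun k _ => F k)) => k.
  exact: (finite_measure_integrable_cst P (F k) measurableT).
rewrite -sumEFin; apply: eq_bigr => k _.
transitivity (\int[P]_(w in H @^-1` [set k]) (F k)%:E)%E.
  by apply: eq_integral => w; rewrite inE /= => ->.
by rewrite integral_cst // EFinM fineK ?fin_num_measure // muleC.
Qed.

End finite_valued.

Section histories.
Context {R : realType} (S A : finType) d (T : measurableType d) (P : probability T R).
Variables (s_ : nat -> T -> S) (a_ : nat -> T -> A).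
Hypothesis ms : forall t x, measurable (s_ t @^-1` [set x]).
Hypothesis ma : forall t b, measurable (a_ t @^-1` [set b]).

Definition history (t : nat) (w : T) : {ffun 'I_t -> S * A} :=
  [ffun u : 'I_t => (s_ u w, a_ u w)].

(** Path events are indexed by infinite paths.  [history_state] and
    [history_action] extend a finite history to such a path, with the state and
    the action at time [t] and the later states chosen freely. *)
Definition history_state t (h : {ffun 'I_t -> S * A}) (x y : S) (u : nat) : S :=
  if insub u is Some i then (h i).1 else if u == t then x else y.

Definition history_action t (h : {ffun 'I_t -> S * A}) (b : A) (u : nat) : A :=
  if insub u is Some i then (h i).2 else b.

Lemma history_state_t t (h : {ffun 'I_t -> S * A}) x y : history_state h x y t = x.
Proof. by rewrite /history_state insubF ?ltnn // eqxx. Qed.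

Lemma history_state_tS t (h : {ffun 'I_t -> S * A}) x y : history_state h x y t.+1 = y.
Proof. by rewrite /history_state insubF ?ltnNge ?leqnSn // gtn_eqF. Qed.

Lemma history_action_t t (h : {ffun 'I_t -> S * A}) b : history_action h b t = b.
Proof. by rewrite /history_action insubF ?ltnn. Qed.

Lemma measurable_history t h : measurable (history t @^-1` [set h]).
Proof.
rewrite (_ : _ @^-1` _ = \bigcap_(u in [set: 'I_t])
    (s_ u @^-1` [set (h u).1] `&` a_ u @^-1` [set (h u).2])).
  by apply: fin_bigcap_measurable => // u _; exact: measurableI.
apply/seteqP; split=> w /=.
  by move=> <- u _; rewrite ffunE.
move=> hw; apply/ffunP => u; rewrite ffunE; have [/= -> ->] := hw u I.
by case: (h u).
Qed.

Lemma path_event_history t (h : {ffun 'I_t -> S * A}) x y b :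
  path_event s_ a_ t (history_state h x y) (history_action h b) =
  history t @^-1` [set h] `&` s_ t @^-1` [set x].
Proof.
apply/seteqP; split=> w /=.
  rewrite /path_event /= history_state_t => -[st hu]; split => //.
  apply/ffunP => u; rewrite ffunE; have [] := hu u (ltn_ord u).
  by rewrite /history_state /history_action valK => -> ->; case: (h u).
move=> [<- st]; rewrite /path_event /= history_state_t; split => // u ut.
by rewrite /history_state /history_action insubT /= ffunE.
Qed.

Lemma probability_histories t x y b (B : set T) : measurable B ->
  (P (s_ t @^-1` [set x] `&` B) = \sum_(h : {ffun 'I_t -> S * A})
    P (path_event s_ a_ t (history_state h x y) (history_action h b) `&` B))%E.
Proof.
move=> mB; rewrite (probability_partition P (@measurable_history t)); last exact: measurableI.
by apply: eq_bigr => h _; rewrite path_event_history setIA.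
Qed.

(** The laws that define a process are conditional on a whole past; summing over
    the finitely many histories makes them conditional on the present state. *)
Lemma conditional_histories t x b (B : set T) (k : \bar R) :
  measurable B -> (0 <= k)%E ->
  (forall x' b', x' t = x -> b' t = b ->
    P (path_event s_ a_ t x' b' `&` B) = (P (path_event s_ a_ t x' b') * k)%E) ->
  P (s_ t @^-1` [set x] `&` B) = (P (s_ t @^-1` [set x]) * k)%E.
Proof.
move=> mB k0 cond; rewrite (probability_histories _ x x b mB).
rewrite -[in RHS](setIT (s_ t @^-1` [set x])) (probability_histories _ x x b measurableT).
rewrite ge0_sume_distrl //; apply: eq_bigr => h _.
by rewrite setIT cond ?history_state_t ?history_action_t.
Qed.

Lemma transition_probability (q : S -> A -> S -> R) :
  (forall x b y, 0 <= q x b y) ->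
  (forall t x b, P (path_event s_ a_ t.+1 x b) =
    (P (path_event s_ a_ t x b `&` a_ t @^-1` [set b t]) *
     (q (x t) (b t) (x t.+1))%:E)%E) ->
  forall t x b y,
    P (s_ t @^-1` [set x] `&` (a_ t @^-1` [set b] `&` s_ t.+1 @^-1` [set y])) =
    (P (s_ t @^-1` [set x] `&` a_ t @^-1` [set b]) * (q x b y)%:E)%E.
Proof.
move=> q0 step t x b y.
rewrite (probability_histories _ x y b); last exact: measurableI.
rewrite (probability_histories _ x y b) //.
rewrite ge0_sume_distrl //; apply: eq_bigr => h _.
have := step t (history_state h x y) (history_action h b).
rewrite history_state_t history_state_tS history_action_t => <-.
congr (P _); apply/seteqP; split=> w /=.
  move=> [[st hu] [at_ sS]]; split; first by rewrite history_state_tS.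
  move=> u; rewrite ltnS leq_eqVlt => /orP[/eqP ->|]; last exact: hu.
  by rewrite history_action_t.
move=> [sS hu]; have [st at_] := hu t (ltnSn t).
split; last by split; [rewrite at_ history_action_t|rewrite sS history_state_tS].
by split => // u ut; apply: hu; exact: ltnW.
Qed.

Lemma mean_next_state (q : S -> A -> S -> R) (V : S -> R) :
  (forall x b y, 0 <= q x b y) ->
  (forall t x b, P (path_event s_ a_ t.+1 x b) =
    (P (path_event s_ a_ t x b `&` a_ t @^-1` [set b t]) *
     (q (x t) (b t) (x t.+1))%:E)%E) ->
  forall t,
  \sum_y fine (P (s_ t.+1 @^-1` [set y])) * V y =
  \sum_(i : S * A) fine (P ((fun w => (s_ t w, a_ t w)) @^-1` [set i])) *
    \sum_y q i.1 i.2 y * V y.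
Proof.
move=> q0 step t.
have mp (i : S * A) : measurable ((fun w => (s_ t w, a_ t w)) @^-1` [set i]).
  rewrite (_ : _ @^-1` _ = s_ t @^-1` [set i.1] `&` a_ t @^-1` [set i.2]).
    exact: measurableI.
  by apply/seteqP; split=> w /=; [move=> <-|case: i => x b /= [-> ->]].
have yE y : fine (P (s_ t.+1 @^-1` [set y])) = \sum_(i : S * A)
    fine (P ((fun w => (s_ t w, a_ t w)) @^-1` [set i])) * q i.1 i.2 y.
  rewrite (probability_partition P mp (ms t.+1 y)).
  rewrite -[RHS]/(fine (_%:E)) -sumEFin; congr fine; apply: eq_bigr => i _.
  have pE : (fun w => (s_ t w, a_ t w)) @^-1` [set i] =
      s_ t @^-1` [set i.1] `&` a_ t @^-1` [set i.2].
    by apply/seteqP; split=> w /=; [move=> <-|case: i => x b /= [-> ->]].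
  rewrite EFinM fineK ?fin_num_measure // pE -setIA.
  exact: transition_probability.
under eq_bigr do rewrite yE mulr_suml.
rewrite exchange_big /=; apply: eq_bigr => i _; rewrite mulr_sumr.
by apply: eq_bigr => y _; rewrite mulrA.
Qed.

End histories.

Lemma iid_gumbel_vector (R : realType) d (T : measurableType d) (P : probability T R)
    (S A : finType) (e : S * A -> {RV P >-> R}) (E : set T) (x : S) :
  iid_gumbel e ->
  (forall B : S * A -> set R, (forall i, measurable (B i)) ->
    P (E `&` rect_event (fun i => e i : T -> R) B) =
    (P E * P (rect_event (fun i => e i : T -> R) B))%E) ->
  gumbel_vector_on P E (fun a => e (x, a) : T -> R).
Proof.
move=> [gum iid] indep z.
pose B (i : S * A) : set R := if i.1 == x then `]-oo, z i.2]%classic else setT.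
have mB i : measurable (B i) by rewrite /B; case: ifP.
rewrite (_ : [set w | _] = rect_event (fun i => e i : T -> R) B); last first.
  apply/seteqP; split=> w /= h.
    by move=> [y a]; rewrite /B /=; case: eqP => // ->; rewrite /= in_itv /=.
  by move=> a; have := h (x, a); rewrite /B /= eqxx /= in_itv.
rewrite indep // iid //; congr (_ * _%:E)%E.
rewrite (eq_bigr (fun i => fine (P (e (i.1, i.2) @^-1` B (i.1, i.2))))); last by case.
rewrite -(pair_bigA _ (fun y a => fine (P (e (y, a) @^-1` B (y, a))))) /=.
rewrite (bigD1 x) //= [X in _ * X]big1 ?mulr1 => [|y yx].
  apply: eq_bigr => a _; rewrite /B /= eqxx.
  have := gum (x, a) (z a); rewrite /cdf /distribution /pushforward => -> //.
apply: big1 => a _; rewrite /B /= (negbTE yx) preimage_setT.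
by rewrite probability_setT.
Qed.

(** * The Bellman equation and the verification principle *)
Section bellman.
Context {R : realType} (M : mdp R) (a0 : action M) (eta : R).
Hypothesis eta_ge0 : 0 <= eta.

Definition q_value (r : reward M) (V : state M -> R) (s : state M) (a : action M) : R :=
  r s a + discount M * \sum_(s' : state M) trans s a s' * V s'.

Definition bellman_fixpoint (r : reward M) (V : state M -> R) :=
  forall s, V s = smax a0 eta (q_value r V s).

(** The Bellman operator is monotone, and the constants [- K] and [K] with
    [K = B + gamma * K] are a sub- and a super-solution. *)
Lemma bellman_fixpoint_exists (r : reward M) : exists V, bellman_fixpoint r V.
Proof.
pose g := discount M.
have g0 : 0 <= g by exact: discount_ge0.
have g1 : 0 < 1 - g by rewrite subr_gt0 discount_lt1.
pose B := \sum_s `|smax a0 eta (r s)|.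
have B0 : 0 <= B by exact: sumr_ge0.
have sB s : `|smax a0 eta (r s)| <= B.
  by rewrite /B (bigD1 s) //= lerDl sumr_ge0.
have cst k s : smax a0 eta (q_value r (fun=> k) s) = smax a0 eta (r s) + g * k.
  rewrite -smaxD //; congr smax; apply/funext => a; rewrite /q_value.
  by rewrite -mulr_suml trans_sum1 mul1r.
pose K := B / (1 - g).
have K0 : 0 <= K by rewrite divr_ge0 // ltW.
have KE : K = B + g * K by rewrite /K; field; rewrite gt_eqF.
apply: (@knaster_tarski_fixpoint _ _
  (fun V s => smax a0 eta (q_value r V s)) (- K) K).
- move=> V W VW s; apply: smax_mono => // a; rewrite /q_value lerD2l ler_wpM2l //.
  by apply: ler_sum => s' _; rewrite ler_wpM2l ?trans_ge0.
- by lra.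
- by move=> s; rewrite cst; have := sB s; rewrite ler_norml => /andP[]; lra.
- by move=> s; rewrite cst; have := sB s; rewrite ler_norml => /andP[]; lra.
Qed.

End bellman.

Section process_verification.
Context {R : realType} (M : mdp R) d (T : measurableType d) (P : probability T R).
Variables (s_ : nat -> T -> state M) (a_ : nat -> T -> action M).
Variables (s0 : state M) (V : state M -> R) (Y : nat -> T -> R) (C : R).
Hypothesis ms : forall t x, measurable (s_ t @^-1` [set x]).
Hypothesis ma : forall t b, measurable (a_ t @^-1` [set b]).
Hypothesis start : P (s_ 0%N @^-1` [set s0]) = 1%E.
Hypothesis step : forall t x b, P (path_event s_ a_ t.+1 x b) =
  (P (path_event s_ a_ t x b `&` a_ t @^-1` [set b t]) *
   (trans (x t) (b t) (x t.+1))%:E)%E.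
Hypothesis iY : forall t, P.-integrable setT (fun w => (Y t w)%:E).
Hypothesis YC : forall t, (\int[P]_w `|Y t w|%:E <= C%:E)%E.

Let g := discount M.

Lemma measurable_pair t (i : state M * action M) :
  measurable ((fun w => (s_ t w, a_ t w)) @^-1` [set i]).
Proof.
rewrite (_ : _ @^-1` _ = s_ t @^-1` [set i.1] `&` a_ t @^-1` [set i.2]).
  exact: measurableI.
by apply/seteqP; split=> w /=; [move=> <-|case: i => x b /= [-> ->]].
Qed.

Let mean t := \sum_x fine (P (s_ t @^-1` [set x])) * V x.

Let mean0 : mean 0 = V s0.
Proof.
have sum1 : \sum_x fine (P (s_ 0%N @^-1` [set x])) = 1.
  have := probability_partition P (ms 0) measurableT.
  rewrite probability_setT => h; apply: EFin_inj; rewrite -sumEFin h.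
  by apply: eq_bigr => x _; rewrite setIT fineK ?fin_num_measure.
have others x : x != s0 -> fine (P (s_ 0%N @^-1` [set x])) = 0.
  move=> xs; have /eqP : \sum_(i | i != s0) fine (P (s_ 0%N @^-1` [set i])) = 0.
    by move: sum1; rewrite (bigD1 s0) //= start /=; lra.
  rewrite psumr_eq0; last by move=> i _; rewrite fine_ge0.
  by move=> /allP /(_ x); rewrite mem_index_enum xs => /(_ isT) /eqP.
rewrite /mean (bigD1 s0) //= start mul1r big1 ?addr0 // => x xs.
by rewrite others ?mul0r.
Qed.

Let mean_bound t : `|mean t| <= \sum_x `|V x|.
Proof.
apply: le_trans (ler_norm_sum _ _ _) _; apply: ler_sum => x _.
rewrite normrM ler_piMl // ger0_norm ?fine_ge0 //.
by rewrite -lee_fin fineK ?fin_num_measure // probability_le1.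
Qed.

Let stage t w :=
  (Y t w + g * \sum_s' trans (s_ t w) (a_ t w) s' * V s')%R.

Lemma integrable_stage t : P.-integrable setT (fun w => (stage t w)%:E).
Proof.
rewrite /stage; under eq_fun do rewrite EFinD.
apply: integrableD => //.
apply: (@integrable_finite_valued _ _ _ P _ _ (measurable_pair t)
  (fun i _ => g * \sum_s' trans i.1 i.2 s' * V s')) => i.
exact: (finite_measure_integrable_cst P _ measurableT).
Qed.

Let stageE t : (\int[P]_w (stage t w)%:E =
  (fine (\int[P]_w (Y t w)%:E)%E + g * mean t.+1)%:E)%E.
Proof.
have := integrable_stage t; rewrite /stage => ist.
under eq_integral do rewrite EFinD.
rewrite integralD //; last first.
  apply: (@integrable_finite_valued _ _ _ P _ _ (measurable_pair t)
    (fun i _ => g * \sum_s' trans i.1 i.2 s' * V s')) => i.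
  exact: (finite_measure_integrable_cst P _ measurableT).
rewrite (@integral_finite_valued _ _ _ P _ _ (measurable_pair t)
  (fun i => g * \sum_s' trans i.1 i.2 s' * V s')).
rewrite EFinD fineK; last exact: integrable_fin_num.
congr (_ + _%:E)%E.
rewrite /mean (mean_next_state ms ma _ (@trans_ge0 _ M) step) mulr_sumr.
by apply: eq_bigr => i _; rewrite mulrCA.
Qed.

Let mY t : measurable_fun setT (Y t).
Proof. by have /integrableP[/measurable_EFinP] := iY t. Qed.

(** Optimality of a stage is a condition on each event [s_ t = x] because the
    mean of [V (s_ t.+1)] equals that of a function of the current state and
    action, by [mean_next_state]. *)
Lemma return_le :
  (forall t x, (\int[P]_(w in s_ t @^-1` [set x]) (stage t w)%:E <=
                P (s_ t @^-1` [set x]) * (V x)%:E)%E) ->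
  ('E_P[fun w => discounted_sum g (fun t => Y t w)] <= (V s0)%:E)%E.
Proof.
move=> opt; rewrite -mean0.
apply: (verification_le (discount_ge0 M) (discount_lt1 M) mY YC mean_bound) => t.
rewrite -lee_fin -stageE (integral_partition (ms t) (integrable_stage t)).
rewrite -sumEFin; apply: lee_sum => x _.
by rewrite EFinM fineK ?fin_num_measure.
Qed.

Lemma return_eq :
  (forall t x, (\int[P]_(w in s_ t @^-1` [set x]) (stage t w)%:E =
                P (s_ t @^-1` [set x]) * (V x)%:E)%E) ->
  ('E_P[fun w => discounted_sum g (fun t => Y t w)] = (V s0)%:E)%E.
Proof.
move=> opt; rewrite -mean0.
apply: (verification_eq (discount_ge0 M) (discount_lt1 M) mY YC mean_bound) => t.
apply: EFin_inj; rewrite -stageE (integral_partition (ms t) (integrable_stage t)).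
rewrite -sumEFin; apply: eq_bigr => x _.
by rewrite EFinM fineK ?fin_num_measure.
Qed.

End process_verification.

(** * Returns under policies and under decision rules *)
Lemma measurable_path_event (S A : finType) d (T : measurableType d)
    (s_ : nat -> T -> S) (a_ : nat -> T -> A) :
  (forall t x, measurable (s_ t @^-1` [set x])) ->
  (forall t b, measurable (a_ t @^-1` [set b])) ->
  forall t x b, measurable (path_event s_ a_ t x b).
Proof.
move=> ms ma t x b.
rewrite (_ : path_event _ _ _ _ _ = s_ t @^-1` [set x t] `&` \bigcap_(u in [set: 'I_t])
    (s_ u @^-1` [set x u] `&` a_ u @^-1` [set b u])).
  apply: measurableI => //; apply: fin_bigcap_measurable => // u _.
  exact: measurableI.
apply/seteqP; split=> w [st h]; split => // u.
  by move=> _; have [] := h u (ltn_ord u).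
by move=> ut; have [] := h (Ordinal ut) I.
Qed.

Lemma normr_xlnx_le1 (R : realType) (p : R) : 0 <= p <= 1 -> `|p * ln p| <= 1.
Proof.
move=> /andP[p0 p1]; have [->|pn0] := eqVneq p 0; first by rewrite mul0r normr0.
have pp : 0 < p by rewrite lt_neqAle eq_sym pn0.
have lnp : ln p <= 0 by rewrite -ln1 ler_ln ?posrE.
rewrite ler0_norm; last by rewrite mulr_ge0_le0.
have h : ln p^-1 <= p^-1 - 1.
  have := @le_ln1Dx R (p^-1 - 1).
  by rewrite addrCA subrr addr0; apply; rewrite ltrBrDl subrr invr_gt0.
rewrite lnV ?posrE // in h.
have := ler_wpM2l p0 h; rewrite mulrBr mulfV // mulr1 mulrN; lra.
Qed.

Section regularized_return.
Context {R : realType} (M : mdp R) (a0 : action M) (eta : R) (r : reward M).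
Variables (V : state M -> R).
Hypotheses (eta_ge0 : 0 <= eta) (VE : bellman_fixpoint a0 eta r V).
Context d (T : measurableType d) (P : probability T R).
Variables (pi : nat -> state M -> action M -> R) (s0 : state M).
Variables (s_ : nat -> T -> state M) (a_ : nat -> T -> action M).
Hypothesis pi_policy : forall t, is_policy (pi t).
Hypothesis proc : policy_process pi s0 P s_ a_.

Let Y t w := r (s_ t w) (a_ t w) + entropy_bonus eta (pi t (s_ t w)).

Let ms t x : measurable (s_ t @^-1` [set x]). Proof. by case: proc => -[]. Qed.
Let ma t b : measurable (a_ t @^-1` [set b]). Proof. by case: proc => -[]. Qed.

Let pi_le1 t x b : 0 <= pi t x b <= 1.
Proof.
have [p0 p1] := pi_policy t; rewrite p0 /= -(p1 x) (bigD1 b) //= lerDl.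
by apply: sumr_ge0 => b' _; exact: p0.
Qed.

Let C := \sum_(i : state M * action M) `|r i.1 i.2| + eta * #|action M|%:R.

Let Y_bound t w : `|Y t w| <= C.
Proof.
apply: le_trans (ler_normD _ _) _; apply: lerD.
  by rewrite (bigD1 (s_ t w, a_ t w)) //= lerDl sumr_ge0.
rewrite /entropy_bonus normrM normrN (ger0_norm eta_ge0) // ler_wpM2l //.
apply: le_trans (ler_norm_sum _ _ _) _.
rewrite -sum1_card natr_sum; apply: ler_sum => b _; exact: normr_xlnx_le1.
Qed.

Let iY t : P.-integrable setT (fun w => (Y t w)%:E).
Proof.
apply: (@integrable_finite_valued _ _ _ P _ _ (measurable_pair ms ma t)
  (fun i _ => r i.1 i.2 + entropy_bonus eta (pi t i.1))) => i.
exact: (finite_measure_integrable_cst P _ measurableT).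
Qed.

Let YC t : (\int[P]_w `|Y t w|%:E <= C%:E)%E.
Proof.
apply: (@le_trans _ _ (\int[P]_w C%:E)%E).
  apply: ge0_le_integral => //.
  - have /integrableP[/measurable_EFinP mY _] := iY t.
    by apply/measurable_EFinP; exact: measurableT_comp.
  - by move=> w _; rewrite lee_fin.
by rewrite integral_cst //= probability_setT mule1.
Qed.

(** The stage is a function of the finite-valued pair [(s_ t, a_ t)]. *)
Let policy_stage t x : (\int[P]_(w in s_ t @^-1` [set x])
    (Y t w + discount M * \sum_s' trans (s_ t w) (a_ t w) s' * V s')%:E =
  P (s_ t @^-1` [set x]) *
    (\sum_b pi t x b * q_value r V x b + entropy_bonus eta (pi t x))%:E)%E.
Proof.
pose G (i : state M * action M) : R :=
  if i.1 == x then q_value r V x i.2 + entropy_bonus eta (pi t x) else 0.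
have pairE b : P ((fun w => (s_ t w, a_ t w)) @^-1` [set (x, b)]) =
    (P (s_ t @^-1` [set x]) * (pi t x b)%:E)%E.
  have := @conditional_histories R _ _ _ _ P s_ a_ ms ma t x b (a_ t @^-1` [set b]) (pi t x b)%:E.
  rewrite (_ : _ `&` _ = (fun w => (s_ t w, a_ t w)) @^-1` [set (x, b)]); last first.
    by apply/seteqP; split=> w /=; [move=> [-> ->]|move=> [-> ->]].
  apply => //; first by rewrite lee_fin; have /andP[] := pi_le1 t x b.
  move=> x' b' xt bt; case: proc => _ _ act _.
  by have := act t x' b'; rewrite xt bt.
transitivity (\int[P]_w (G (s_ t w, a_ t w))%:E)%E.
  rewrite integral_mkcond; apply: eq_integral => w _.
  rewrite patchE /G /=; case: ifPn => [|].
    rewrite inE /= => sx; rewrite sx eqxx /Y /q_value sx; congr EFin; ring.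
  by rewrite notin_setE /= => /eqP/negbTE ->.
rewrite (integral_finite_valued P (measurable_pair ms ma t) G).
have finx : P (s_ t @^-1` [set x]) \is a fin_num by rewrite fin_num_measure.
rewrite -[in RHS](fineK finx) -EFinM; congr EFin.
rewrite (eq_bigr (fun i => fine (P ((fun w => (s_ t w, a_ t w)) @^-1` [set (i.1, i.2)]))
   * G (i.1, i.2))); last by case.
rewrite -(pair_bigA _ (fun y b => fine (P ((fun w => (s_ t w, a_ t w)) @^-1` [set (y, b)]))
   * G (y, b))) /=.
rewrite (bigD1 x) //= [X in _ + X]big1 ?addr0; last first.
  by move=> y yx; apply: big1 => b _; rewrite /G /= (negbTE yx) mulr0.
rewrite -[X in _ * (_ + X)]mul1r -(proj2 (pi_policy t) x) mulr_suml -big_split /= mulr_sumr.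
apply: eq_bigr => b _; rewrite pairE -[P _]fineK // -EFinM /= /G /= eqxx; ring.
Qed.

Lemma regularized_return_le :
  ('E_P[fun w => discounted_sum (discount M) (fun t => Y t w)] <= (V s0)%:E)%E.
Proof.
case: (proc) => _ start _ step.
apply: (return_le ms ma start step iY YC) => t x.
rewrite policy_stage lee_wpmul2l // lee_fin VE.
by have [p0 p1] := pi_policy t; exact: gibbs_inequality.
Qed.

Lemma regularized_return_eq :
  (forall t s, pi t s = softmax a0 eta (q_value r V s)) ->
  ('E_P[fun w => discounted_sum (discount M) (fun t => Y t w)] = (V s0)%:E)%E.
Proof.
move=> piE; case: (proc) => _ start _ step.
apply: (return_eq ms ma start step iY YC) => t x.
by rewrite policy_stage piE gibbs_equality // -VE.
Qed.

End regularized_return.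

Section noisy_return.
Context {R : realType} (M : mdp R) (a0 : action M) (eta : R) (r : reward M).
Variables (V : state M -> R).
Hypothesis eta_ge0 : 0 <= eta.
Hypothesis VE : forall s, V s = smax a0 eta (q_value r V s) + eta * gumbel_mean.
Context d (T : measurableType d) (P : probability T R).
Variables (psi : nat -> state M -> (action M -> R) -> action M) (s0 : state M).
Variables (s_ : nat -> T -> state M) (a_ : nat -> T -> action M).
Variable e_ : nat -> state M * action M -> {RV P >-> R}.
Hypothesis proc : rule_process psi s0 s_ a_ e_.

Let Y t w := r (s_ t w) (a_ t w) + eta * e_ t (s_ t w, a_ t w) w.

Let ms t x : measurable (s_ t @^-1` [set x]). Proof. by case: proc => -[]. Qed.
Let ma t b : measurable (a_ t @^-1` [set b]). Proof. by case: proc => -[]. Qed.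

Let noisy_path_cylinder t x b (B : nat -> state M * action M -> set R) :
  (forall u i, (u < t)%N -> B u i = setT) ->
  noisy_path_event s_ a_ (fun t i => e_ t i : T -> R) t x b B = path_event s_ a_ t x b.
Proof.
move=> BT; apply/seteqP; split=> w; first by case.
by move=> pw; split => // u ut i; rewrite BT.
Qed.

Lemma rule_process_step t x b : P (path_event s_ a_ t.+1 x b) =
  (P (path_event s_ a_ t x b `&` a_ t @^-1` [set b t]) *
   (trans (x t) (b t) (x t.+1))%:E)%E.
Proof.
case: proc => _ _ _ _ /(_ t x b (fun _ _ => setT)).
rewrite !noisy_path_cylinder // => -> //; congr (P _ * _)%E.
by apply/seteqP; split=> w /= [[pw ?] aw] //.
Qed.

Lemma rule_process_indep t x b (B : state M * action M -> set R) :
  (forall i, measurable (B i)) ->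
  P (path_event s_ a_ t x b `&` rect_event (fun i => e_ t i : T -> R) B) =
  (P (path_event s_ a_ t x b) * P (rect_event (fun i => e_ t i : T -> R) B))%E.
Proof.
move=> mB; case: proc => _ _ [_ indep] _ _.
have := indep t x b (fun u => if u == t then B else fun=> setT).
rewrite noisy_path_cylinder; last by move=> u i ut; rewrite ltn_eqF.
by rewrite eqxx; apply => u i; case: ifP.
Qed.

Lemma gumbel_vector_path t x b y : gumbel_vector_on P (path_event s_ a_ t x b)
  (fun a => e_ t (y, a) : T -> R).
Proof.
apply: iid_gumbel_vector; first by case: proc => _ _ [].
by move=> B mB; exact: rule_process_indep.
Qed.

Lemma measurable_rect (B : state M * action M -> set R) t :
  (forall i, measurable (B i)) ->
  measurable (rect_event (fun i => e_ t i : T -> R) B).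
Proof.
move=> mB.
rewrite (_ : rect_event _ B = \bigcap_(i in [set: state M * action M]) (e_ t i @^-1` B i)).
  by apply: fin_bigcap_measurable => // i _; exact: measurable_funPTI.
by apply/seteqP; split=> w /= h i; [move=> _|]; exact: h.
Qed.

Lemma gumbel_vector_state t x : gumbel_vector_on P (s_ t @^-1` [set x])
  (fun a => e_ t (x, a) : T -> R).
Proof.
apply: iid_gumbel_vector; first by case: proc => _ _ [].
move=> B mB; apply: (conditional_histories ms ma (b := a0)) => //.
  exact: measurable_rect.
by move=> x' b' _ _; exact: rule_process_indep.
Qed.

Let noise_abs t i : (\int[P]_w `|e_ t i w|%:E =
  \int[distribution (@coin_prob R) coin_gumbel]_y `|y%:E|)%E.
Proof.
case: proc => _ _ [/(_ t)[gum _] _] _ _.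
have := @ge0_integral_gumbel_on_event R _ _ P setT (e_ t i) (fun y => `|y%:E|)%E.
rewrite probability_setT mul1e; apply => //.
  move=> z; rewrite mul1e setTI; have := gum i z.
  rewrite /cdf /distribution /pushforward /gumbel_cdf => <-; exact: congr1.
have : measurable_fun setT (EFin \o (fun y : R => `|y|)).
  by apply/measurable_EFinP; exact: measurableT_comp.
exact.
Qed.

Let K := fine (\int[distribution (@coin_prob R) coin_gumbel]_y `|y%:E|)%E.

Let noise_absK t i : (\int[P]_w `|e_ t i w|%:E = K%:E)%E.
Proof.
rewrite noise_abs /K fineK //.
have := gumbel_law_integrable => /(_ R) /integrable_abse iG.
exact: (integrable_fin_num measurableT iG).
Qed.

Let inoise t i : P.-integrable setT (fun w => (e_ t i w)%:E).
Proof.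
apply/integrableP; split; first exact/measurable_EFinP.
by under eq_integral do rewrite abse_EFin; rewrite noise_absK ltry.
Qed.

Let iterm t i : P.-integrable setT (fun w => (r i.1 i.2 + eta * e_ t i w)%:E).
Proof.
under eq_fun do rewrite EFinD EFinM.
apply: integrableD => //; last exact: integrableZl.
exact: (finite_measure_integrable_cst P _ measurableT).
Qed.

Let iY t : P.-integrable setT (fun w => (Y t w)%:E).
Proof.
have := @integrable_finite_valued _ _ _ P _ _ (measurable_pair ms ma t)
  (fun i w => r i.1 i.2 + eta * e_ t i w) (iterm t).
exact.
Qed.

Let C := \sum_(i : state M * action M) (`|r i.1 i.2| + eta * K).

Let YC t : (\int[P]_w `|Y t w|%:E <= C%:E)%E.
Proof.
have ia i : P.-integrable setT (fun w => (`|r i.1 i.2|%:E + eta%:E * `|e_ t i w|%:E)%E).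
  apply: integrableD => //; last first.
    by apply: integrableZl => //; have := integrable_abse (inoise t i); exact.
  exact: (finite_measure_integrable_cst P _ measurableT).
have isum : P.-integrable setT (fun w =>
    \sum_(i : state M * action M) (`|r i.1 i.2|%:E + eta%:E * `|e_ t i w|%:E)%E).
  by apply: integrable_sum.
apply: (@le_trans _ _ (\int[P]_w
    \sum_(i : state M * action M) (`|r i.1 i.2|%:E + eta%:E * `|e_ t i w|%:E))%E).
  apply: ge0_le_integral => //.
  - have /integrableP[/measurable_EFinP mY _] := iY t.
    by apply/measurable_EFinP; exact: measurableT_comp.
  - by have /integrableP[] := isum.
  move=> w _; under eq_bigr do rewrite -EFinM -EFinD.
  rewrite sumEFin lee_fin.
  rewrite (bigD1 (s_ t w, a_ t w)) //= -[X in X <= _]addr0; apply: lerD.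
    apply: le_trans (ler_normD _ _) _; rewrite lerD2l normrM ger0_norm //.
  by apply: sumr_ge0 => i _; rewrite addr_ge0 // mulr_ge0.
rewrite integral_sum // /C -sumEFin lee_sum // => i _.
rewrite integralD //; last 2 first.
- exact: (finite_measure_integrable_cst P _ measurableT).
- by apply: integrableZl => //; have := integrable_abse (inoise t i); exact.
rewrite integral_cst //= probability_setT mule1 integralZl //; last first.
  by have := integrable_abse (inoise t i); exact.
by rewrite noise_absK -EFinM -EFinD.
Qed.

Let greedy x (e : action M -> R) := argmax a0 (fun a => q_value r V x a + eta * e a).

Let best x t w := q_value r V x (greedy x (fun a => e_ t (x, a) w)) +
  eta * e_ t (x, greedy x (fun a => e_ t (x, a) w)) w.

Let best_max x t : is_max_of (fun a => e_ t (x, a) : T -> R) eta (q_value r V x) (best x t).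
Proof.
split=> w; last by exists (greedy x (fun a => e_ t (x, a) w)).
by move=> a; exact: (argmaxP a0 (fun a => q_value r V x a + eta * e_ t (x, a) w)).
Qed.

Let best_integral x t :
  P.-integrable (s_ t @^-1` [set x]) (fun w => (best x t w)%:E) /\
  (\int[P]_(w in s_ t @^-1` [set x]) (best x t w)%:E =
   P (s_ t @^-1` [set x]) * (V x)%:E)%E.
Proof.
rewrite VE.
have me a : measurable_fun setT (e_ t (x, a)) by exact: measurable_funPT.
exact: (@integral_gumbel_max _ _ _ P _ a0 _ _ _ (ms t x) me (gumbel_vector_state t x)
  eta_ge0 _ _ (best_max x t)).
Qed.

Let stageE t x w : s_ t w = x ->
  Y t w + discount M * \sum_s' trans (s_ t w) (a_ t w) s' * V s' =
  q_value r V x (a_ t w) + eta * e_ t (x, a_ t w) w.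
Proof. by move=> <-; rewrite /Y /q_value; ring. Qed.

(** Whatever the rule, the stage is at most the maximum over all actions, whose
    mean on [s_ t = x] is [V x] by max-stability. *)
Lemma noisy_return_le :
  ('E_P[fun w => discounted_sum (discount M) (fun t => Y t w)] <= (V s0)%:E)%E.
Proof.
case: (proc) => _ start _ _ _.
apply: (return_le ms ma start rule_process_step iY YC) => t x.
have [ib <-] := best_integral x t.
apply: le_integral => //.
  apply: integrableS (integrable_stage V ms ma iY t) => //.
move=> w; rewrite inE /= => sx; rewrite lee_fin (stageE sx).
exact: (best_max x t).1.
Qed.

Lemma noisy_return_eq : (forall t s e, psi t s e = greedy s e) ->
  ('E_P[fun w => discounted_sum (discount M) (fun t => Y t w)] = (V s0)%:E)%E.
Proof.
move=> psiE; case: (proc) => _ start _ act _.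
apply: (return_eq ms ma start rule_process_step iY YC) => t x.
have [_ <-] := best_integral x t.
apply: eq_integral => w; rewrite inE /= => sx; rewrite (stageE sx).
by rewrite /best act psiE sx.
Qed.

End noisy_return.

(** * Values and optimal policies *)
Lemma softmaxD (R : realType) (A : finType) (a0 : A) (eta : R) (c : A -> R) (k : R) a :
  0 <= eta -> softmax a0 eta (fun b => c b + k) a = softmax a0 eta c a.
Proof.
move=> eta0; rewrite /softmax smaxD // opprD addrACA subrr addr0.
case: ifP => // _; congr (_ == _)%:R.
by rewrite /argmax; congr argmax_of; apply/ffunP => ba; rewrite !ffunE lerD2r.
Qed.

Lemma measurable_argmax (R : realType) d (T : measurableType d) (A : finType) (a0 : A)
    (f : A -> T -> R) a : (forall b, measurable_fun setT (f b)) ->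
  measurable [set w | argmax a0 (fun b => f b w) = a].
Proof.
move=> mf.
apply: (@measurable_finite_tests _ T _ _ (fun ba w => f ba.1 w <= f ba.2 w)
  (argmax_of a0)) => ba.
exact: measurable_fun_ler.
Qed.

Lemma greedy_probability (R : realType) d (T : measurableType d) (P : probability T R)
    (A : finType) (a0 : A) (E : set T) (e : A -> T -> R) (eta : R) (c : A -> R) a :
  measurable E -> (forall b, measurable_fun setT (e b)) -> gumbel_vector_on P E e ->
  0 <= eta ->
  P (E `&` [set w | argmax a0 (fun b => c b + eta * e b w) = a]) =
  (P E * (softmax a0 eta c a)%:E)%E.
Proof.
move=> mE me eE; rewrite le_eqVlt eq_sym => /orP[/eqP ->|eta0].
  have argE w : argmax a0 (fun b => c b + 0 * e b w) = argmax a0 c.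
    by congr argmax; apply/funext => b; rewrite mul0r addr0.
  rewrite /softmax eqxx; case: eqP => [->|ne].
    rewrite mule1; congr (P _); apply/seteqP; split=> w //=; first by case.
  rewrite mule0 (_ : _ `&` _ = set0) ?measure0 //.
  by apply/seteqP; split=> w //= [_]; rewrite argE => /esym.
apply: (@choice_probability _ _ _ P _ a0 E e eta mE me eE (ltW eta0) c
  (fun w => argmax a0 (fun b => c b + eta * e b w)) eta0).
  by move=> w b; exact: (argmaxP a0 (fun b => c b + eta * e b w)).
move=> b; apply: (@measurable_argmax R _ T A a0 (fun b w => c b + eta * e b w)) => b'.
by apply: measurable_funD => //; apply: measurable_funM.
Qed.

Section optimality.
Context {R : realType} (M : mdp R) (a0 : action M) (eta : R).
Hypothesis eta_ge0 : 0 <= eta.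

Definition greedy_rule (r : reward M) (V : state M -> R) (s : state M)
    (e : action M -> R) : action M :=
  argmax a0 (fun a => q_value r V s a + eta * e a).

Lemma greedy_is_decision_rule r V : is_decision_rule (greedy_rule r V).
Proof.
move=> s a.
have := @measurable_argmax R _ (g_sigma_algebraType (@coordinate_events R (action M)))
  _ a0 (fun b e => q_value r V s b + eta * e b) a.
apply => b; apply: measurable_funD => //; apply: measurable_funM => //.
move=> _ U mU; rewrite setTI; apply: sub_sigma_algebra; by exists b, U.
Qed.

Lemma greedy_policy r V :
  policy_of_rule (greedy_rule r V) (fun s => softmax a0 eta (q_value r V s)).
Proof.
exists _, coins, (@coin_prob R),
  (fun i : state M * action M => block_noise i).
have iid := @iid_block_noise R (state M * action M)%type.
split; first exact: iid.
move=> s a.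
have ev : gumbel_vector_on (@coin_prob R) setT
    (fun b => block_noise (R := R) ((s, b) : state M * action M)).
  have := @iid_gumbel_vector R _ coins (@coin_prob R) (state M) (action M)
    (fun i => block_noise i) setT s iid.
  by apply => B _; rewrite setTI probability_setT mul1e.
have mb b : measurable_fun setT (block_noise (R := R) ((s, b) : state M * action M)).
  exact: measurable_block_noise.
have := greedy_probability a0 (q_value r V s) a measurableT mb ev eta_ge0.
by rewrite setTI probability_setT mul1e => <-.
Qed.

(** Forgetting the noise of the process driven by the greedy rule leaves a
    process that follows the softmax policy. *)
Lemma greedy_policy_process r V (s0 : state M) :
  exists (d : measure_display) (T : measurableType d) (P : probability T R)
         (s_ : nat -> T -> state M) (a_ : nat -> T -> action M),
    policy_process (fun _ s => softmax a0 eta (q_value r V s)) s0 P s_ a_.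
Proof.
have [d [T [P [s_ [a_ [e_ proc]]]]]] :=
  rule_process_exists s0 (fun _ : nat => greedy_is_decision_rule r V).
exists d, T, P, s_, a_; case: (proc) => -[ms ma] start _ act _.
split => //; last by move=> t x b; exact: (rule_process_step proc).
move=> t x b.
have me a : measurable_fun setT (e_ t (x t, a)) by exact: measurable_funPT.
rewrite -(greedy_probability a0 (q_value r V (x t)) (b t)
  (measurable_path_event ms ma t x b) me (gumbel_vector_path proc t x b (x t)) eta_ge0).
congr (P _); apply/seteqP; split=> w /= [pw aw]; split => //; have [sw _] := pw.
  by rewrite -aw act sw.
by rewrite act sw.
Qed.

Lemma softmax_is_policy r V :
  is_policy (fun s => softmax a0 eta (q_value r V s) : action M -> R).
Proof. by split=> [s a|s]; [exact: softmax_ge0|exact: softmax_sum1]. Qed.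

Lemma ER_optimal_return r V s : bellman_fixpoint a0 eta r V ->
  ER_return eta r (fun _ s => softmax a0 eta (q_value r V s)) s (V s)%:E.
Proof.
move=> VE; have [d [T [P [s_ [a_ proc]]]]] := greedy_policy_process r V s.
exists d, T, P, s_, a_; split => //.
by rewrite (regularized_return_eq eta_ge0 VE (fun=> softmax_is_policy r V) proc).
Qed.

Lemma ER_value r V s : bellman_fixpoint a0 eta r V ->
  value (EntropyRegularized eta) r s = (V s)%:E.
Proof.
move=> VE; apply/le_anti/andP; split.
  apply: ge_ereal_sup => v [pi pol [d [T [P [s_ [a_ [proc ->]]]]]]].
  exact: (regularized_return_le eta_ge0 VE pol proc).
apply: ereal_sup_ubound; exists (fun _ s => softmax a0 eta (q_value r V s)).
  by move=> _; exact: softmax_is_policy.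
exact: ER_optimal_return.
Qed.

(** The Bellman equation of the EV-MDP: by [integral_gumbel_max] the noise adds
    [eta * gumbel_mean] to the log-sum-exp. *)
Definition noisy_fixpoint (r : reward M) (V : state M -> R) :=
  forall s, V s = smax a0 eta (q_value r V s) + eta * gumbel_mean.

Lemma EV_optimal_return r V s : noisy_fixpoint r V ->
  EV_return eta r (fun=> greedy_rule r V) s (V s)%:E.
Proof.
move=> VE; have [d [T [P [s_ [a_ [e_ proc]]]]]] :=
  rule_process_exists s (fun _ : nat => greedy_is_decision_rule r V).
exists d, T, P, s_, a_, e_; split => //.
by rewrite (noisy_return_eq eta_ge0 VE proc).
Qed.

Lemma EV_value r V s : noisy_fixpoint r V ->
  value (ExtremeValue eta) r s = (V s)%:E.
Proof.
move=> VE; apply/le_anti/andP; split.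
  apply: ge_ereal_sup => v [psi rule [d [T [P [s_ [a_ [e_ [proc ->]]]]]]]].
  exact: (noisy_return_le eta_ge0 VE proc).
apply: ereal_sup_ubound; exists (fun=> greedy_rule r V).
  by move=> _; exact: greedy_is_decision_rule.
exact: EV_optimal_return.
Qed.

Lemma greedy_is_optimal r V : noisy_fixpoint r V ->
  EV_optimal_rule eta r (greedy_rule r V).
Proof.
move=> VE; split.
- exact: greedy_is_decision_rule.
- by move=> s; rewrite (EV_value s VE); exact: EV_optimal_return.
move=> s e a.
have objE b : EV_objective eta r s e b = q_value r V s b + eta * e b.
  rewrite /EV_objective /q_value addrAC; congr (_ + _ * _ + _).
  by apply: eq_bigr => s' _; rewrite (EV_value s' VE).
by rewrite !objE; exact: (argmaxP a0 (fun b => q_value r V s b + eta * e b)).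
Qed.

End optimality.

(** * Comparison of the three frameworks *)
Section equivalence.
Context {R : realType}.

(** The shift by [eta * gumbel_mean] turns one Bellman equation into the other
    and does not affect the softmax. *)
Lemma ER_EV_same (M : mdp R) (eta : R) (rX rY : reward M) :
  0 <= eta -> (forall s a, rX s a - rY s a = eta * gumbel_mean) ->
  (forall s, value (EntropyRegularized eta) rX s = value (ExtremeValue eta) rY s) /\
  exists pi, optimal_policy (EntropyRegularized eta) rX pi /\
             optimal_policy (ExtremeValue eta) rY pi.
Proof.
move=> eta0 rXY; have /card_gt0P[a0 _] := action_gt0 M.
have [V VE] := bellman_fixpoint_exists a0 eta0 rX.
have qE s : q_value rX V s = fun a => q_value rY V s a + eta * gumbel_mean.
  by apply/funext => a; rewrite /q_value -(rXY s a); ring.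
have VE' : noisy_fixpoint a0 eta rY V by move=> s; rewrite VE qE smaxD.
split; first by move=> s; rewrite (ER_value eta0 s VE) (EV_value eta0 s VE').
exists (fun s => softmax a0 eta (q_value rX V s)).
have pol := softmax_is_policy a0 eta0 rX V.
split; split => //.
  by move=> s; rewrite (ER_value eta0 s VE); exact: ER_optimal_return.
exists (greedy_rule a0 eta rY V); first exact: greedy_is_optimal.
have -> : (fun s => softmax a0 eta (q_value rX V s)) =
          (fun s => softmax a0 eta (q_value rY V s)).
  by apply/funext => s; apply/funext => a; rewrite qE softmaxD.
exact: greedy_policy.
Qed.

Lemma ER0_return (M : mdp R) (r : reward M) : ER_return 0 r = standard_return r.
Proof.
apply/funext => pi; apply/funext => s; apply/funext => v.
rewrite /ER_return /standard_return; congr policy_return.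
apply/funext => t; apply/funext => x; apply/funext => a.
by rewrite /entropy_bonus oppr0 mul0r addr0.
Qed.

Lemma standard_value (M : mdp R) (r : reward M) s :
  value Standard r s = value (EntropyRegularized 0) r s.
Proof. by rewrite /= ER0_return. Qed.

Lemma standard_optimal (M : mdp R) (r : reward M) pi :
  optimal_policy (EntropyRegularized 0) r pi -> optimal_policy Standard r pi.
Proof. by rewrite /optimal_policy /= ER0_return. Qed.

Lemma equiv_ER_EV (M : mdp R) (eta : R) : 0 <= eta ->
  equiv_model (Model M (EntropyRegularized eta)) (Model M (ExtremeValue eta)).
Proof.
move=> eta0; exists M, (EntropyRegularized eta), (ExtremeValue eta); split => //.
exists (fun _ _ => eta * gumbel_mean) => rX rY rXY; exact: ER_EV_same.
Qed.

Lemma equiv_ER_standard (M : mdp R) :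
  equiv_model (Model M (EntropyRegularized 0)) (Model M Standard).
Proof.
exists M, (EntropyRegularized 0), Standard; split => //.
exists (fun _ _ => 0) => rX rY rXY.
have -> : rY = rX.
  by apply/funext => s; apply/funext => a; apply/eqP; rewrite eq_sym -subr_eq0 rXY.
split; first by move=> s; rewrite standard_value.
have [] := @ER_EV_same M 0 rX rX (lexx 0).
  by move=> s a; rewrite subrr mul0r.
move=> _ [pi [oER _]]; exists pi; split => //; exact: standard_optimal.
Qed.

Lemma equiv_EV_standard (M : mdp R) :
  equiv_model (Model M (ExtremeValue 0)) (Model M Standard).
Proof.
exists M, (ExtremeValue 0), Standard; split => //.
exists (fun _ _ => 0) => rX rY rXY.
have -> : rY = rX.
  by apply/funext => s; apply/funext => a; apply/eqP; rewrite eq_sym -subr_eq0 rXY.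
have [] := @ER_EV_same M 0 rX rX (lexx 0).
  by move=> s a; rewrite subrr mul0r.
move=> vE [pi [oER oEV]]; split; first by move=> s; rewrite standard_value vE.
by exists pi; split => //; exact: standard_optimal.
Qed.

Lemma two_armed_trans_sum1 (s : unit) (a : bool) : \sum_(s' : unit) (1 : R) = 1.
Proof. by rewrite sumr_const card_unit. Qed.

Lemma two_armed_action_gt0 : (0 < #|{: bool}|)%N. Proof. by rewrite card_bool. Qed.

(** With discount 0 the value is that of a single choice between two actions. *)
Definition two_armed : mdp R :=
  @Mdp R unit bool (fun _ _ _ => 1) 0 two_armed_action_gt0 (fun _ _ _ => ler01)
    two_armed_trans_sum1 (lexx 0) ltr01.

Lemma two_armed_ER_value (eta : R) (r : reward two_armed) : 0 <= eta ->
  value (EntropyRegularized eta) r tt = (smax true eta (r tt))%:E.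
Proof.
move=> eta0.
have [V VE] := @bellman_fixpoint_exists R two_armed true eta eta0 r.
rewrite (@ER_value R two_armed true eta eta0 r V tt VE) VE; congr (smax _ _ _)%:E.
by apply/funext => a; rewrite /q_value /= mul0r addr0.
Qed.

(** From (0, 0), a unit step in either argument raises the log-sum-exp by less
    than 1, whereas a unit step in the argument that attains the maximum raises
    it by 1. *)
Lemma log_sum_exp_not_max (c : R) (x y : R) :
  ~ (forall u v : R, ln (expR u + expR v) + c = Num.max (u + x) (v + y)).
Proof.
move=> h.
have h00 := h 0 0; have h10 := h 1 0; have h01 := h 0 1.
rewrite expR0 in h00 h10 h01.
have lt : ln (expR 1 + 1) < ln (1 + 1) + 1 :> R.
  rewrite -[X in _ < _ + X]expRK -lnM ?posrE ?expR_gt0 ?addr_gt0 //.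
  rewrite ltr_ln ?posrE ?addr_gt0 ?mulr_gt0 ?expR_gt0 //.
  by have := @expR_gt1Dx R 1 (oner_neq0 _); lra.
rewrite [1 + expR 1]addrC in h01.
have ub10 : 1 + x <= ln (expR 1 + 1) + c by rewrite h10 le_max lexx.
have ub01 : 1 + y <= ln (expR 1 + 1) + c by rewrite h01 le_max lexx orbT.
by move: h00; case: (leP (0 + x) (0 + y)) => _; lra.
Qed.

Lemma smax0_bool (c : bool -> R) : smax true 0 c = Num.max (c true) (c false).
Proof.
rewrite /smax eqxx; apply/le_anti; rewrite ge_max !argmaxP /= andbT.
by case: (argmax true c); rewrite le_max lexx ?orbT.
Qed.

Lemma smax1_bool (c : bool -> R) : smax true 1 c = ln (expR (c true) + expR (c false)).
Proof. by rewrite /smax oner_eq0 mul1r big_bool /= !divr1. Qed.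

Lemma standard_not_equiv (k : criterion R) (c : R) :
  (forall r : reward two_armed, value k r tt = (smax true 1 (r tt) + c)%:E) ->
  ~ exists2 Y, standard_framework R Y & equiv_model (Model two_armed k) Y.
Proof.
move=> kE [Y Ystd [M [k' [l [[EM Ek] YE [alpha H]]]]]].
move: Ystd; rewrite YE /standard_framework /= => lE; subst M k' l.
apply: (@log_sum_exp_not_max c (- alpha tt true) (- alpha tt false)) => u v.
pose rX : reward two_armed := fun _ a => if a then u else v.
pose rY : reward two_armed := fun s a => rX s a - alpha s a.
have [|vE _] := H rX rY; first by move=> s a; rewrite /rY opprB addrC subrK.
have := vE tt.
rewrite kE standard_value (two_armed_ER_value rY (lexx 0)) smax1_bool smax0_bool.
by move=> h; exact: (EFin_inj h).
Qed.

End equivalence.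

Theorem proposition1 (R : realType) :
  equiv_framework (ER_framework R) (EV_framework R) /\
  strictly_subsumes (ER_framework R) (standard_framework R) /\
  strictly_subsumes (EV_framework R) (standard_framework R).
Proof.
split; [split|split; split].
- move=> [M k] [eta eta0 /= ->]; exists (Model M (ExtremeValue eta)); first by exists eta.
  exact: equiv_ER_EV.
- move=> [M k] [eta eta0 /= ->].
  exists (Model M (EntropyRegularized eta)); first by exists eta.
  exact: equiv_ER_EV.
- move=> [M k]; rewrite /standard_framework /= => ->.
  exists (Model M (EntropyRegularized 0)); first by exists 0.
  exact: equiv_ER_standard.
- exists (Model (@two_armed R) (EntropyRegularized 1)); first by exists 1.
  apply: (@standard_not_equiv R _ 0) => r.
  by rewrite two_armed_ER_value // addr0.
- move=> [M k]; rewrite /standard_framework /= => ->.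
  exists (Model M (ExtremeValue 0)); first by exists 0.
  exact: equiv_EV_standard.
- exists (Model (@two_armed R) (ExtremeValue 1)); first by exists 1.
  apply: (@standard_not_equiv R _ gumbel_mean) => r.
  have [] := @ER_EV_same R (@two_armed R) 1 (fun s a => r s a + gumbel_mean) r ler01.
    by move=> s a; rewrite mul1r addrAC subrr add0r.
  move=> /(_ tt) <- _.
  by rewrite (two_armed_ER_value _ ler01) smaxD.
Qed.
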